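(* For every $\theta\in(0,\frac12)$ there exists $t_\theta>0$ such that the following holds. Let $(g_n)$ be a sequence of nonnegative integers with $\frac{g_n}{n}\to\theta$, and let $\mathbf{T}_{2n,g_n}$ be a uniformly random triangulation of genus $g_n$ with $2n$ faces. If $x_n,y_n$ are the starting points of two independent uniform oriented edges in $\mathbf{T}_{2n,g_n}$, then \[\mathrm{diam}(\mathbf{T}_{2n,g_n})-d_{\mathbf{T}_{2n,g_n}}(x_n,y_n)\geq t_\theta\log n\] with high probability.
   Context: A map is a finite graph (loops and multiple edges allowed) embedded on a compact connected oriented surface so that the connected components of the complement of the graph, called faces, are topological disks, considered up to homeomorphism; equivalently, a connected oriented surface obtained by gluing finitely many polygons side by side. Its genus is the genus of the surface. Maps are rooted, i.e. equipped with a distinguished oriented edge. The degree of a face is the number of edge-sides incident to it. A triangulation is a rooted map all of whose faces have degree $3$. $\mathcal{T}(2n,g)$ is the (finite) set of triangulations of genus $g$ with $2n$ faces; it is nonempty if and only if $n\ge 2g-1$, and its elements have $3n$ edges and $n+2-2g$ vertices. $\mathbf{T}_{2n,g}$ denotes a uniform random element of $\mathcal{T}(2n,g)$ (so $\mathbf{T}_{2n,g_n}$ is well defined for $n$ large). $d_t$ is the graph distance in $t$ and $\mathrm{diam}(t)$ the maximal graph distance between two vertices of $t$. The two oriented edges are sampled conditionally on $\mathbf{T}_{2n,g_n}$. An event holds with high probability if its probability tends to $1$ as $n\to+\infty$. *)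

(* Defs.v *)
From HB Require Import structures.
From mathcomp Require Import all_boot all_order all_algebra all_fingroup.
From mathcomp Require Import all_classical all_reals all_analysis.

Set Implicit Arguments.
Unset Strict Implicit.
Unset Printing Implicit Defensive.

Import Order.TTheory GRing.Theory Num.Theory.

Section GraphDistance.
Variables (V : finType) (adj : rel V).

Definition walk (k : nat) (u v : V) : bool :=
  [exists p : k.-tuple V, path adj u p && (last u p == v)].

(* The least k such that a walk of length k joins u to v.  A shortest walk
   has fewer than #|V| steps, so searching below #|V| suffices; the value is
   #|V| when u and v are not connected. *)
Definition gdist (u v : V) : nat :=
  find (fun k => walk k u v) (iota 0 #|V|).

End GraphDistance.

(* A gluing of polygons whose set of sides is D, with a distinguished side.
   Orienting the sides so that each polygon lies on their left identifies D
   with the set of oriented edges of the map: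
   - [glue] exchanges the two sides glued together, that is, it reverses
     oriented edges;
   - [next] sends a side to the following one along its polygon. *)
Definition labelled_map (D : finType) := ({perm D} * {perm D} * D)%type.

Section LabelledMaps.
Variable D : finType.
Implicit Types m : labelled_map D.

Definition glue m : {perm D} := m.1.1.
Definition next m : {perm D} := m.1.2.
Definition root m : D := m.2.

(* d |-> next (glue d), which turns around the starting point of d. *)
Definition turn m : {perm D} := (glue m * next m)%g.

Definition vertices m : {set {set D}} := porbits (turn m).
Definition edges m : {set {set D}} := porbits (glue m).
Definition faces m : {set {set D}} := porbits (next m).

Definition is_map m : bool :=
  [&& [forall d, glue m (glue m d) == d],
      [forall d, glue m d != d] &
      [transitive <<[set glue m; next m]>>%g, on [set: D] | 'P]].

Definition euler_char m : int :=
  (#|vertices m|%:Z - #|edges m|%:Z + #|faces m|%:Z)%R.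

Definition has_genus (g : nat) m : bool :=
  (euler_char m == 2%:Z - 2%:Z * g%:Z)%R.

Definition is_triangulation m : bool :=
  is_map m && [forall f in faces m, #|f| == 3].

(* Orientation-preserving homeomorphisms that respect the roots. *)
Definition isomorphic m1 m2 : bool :=
  [exists s : {perm D},
    [&& [forall d, s (glue m1 d) == glue m2 (s d)],
        [forall d, s (next m1 d) == next m2 (s d)] &
        s (root m1) == root m2]].

Definition start m (d : D) : {set D} := porbit (turn m) d.

Definition adjacent m : rel {set D} :=
  [rel u v | [exists d, (start m d == u) && (start m (glue m d) == v)]].

Definition dist m (u v : {set D}) : nat := gdist (adjacent m) u v.

Definition diam m : nat :=
  \max_(u in vertices m) \max_(v in vertices m) dist m u v.

End LabelledMaps.

Lemma isomorphic_equiv (D : finType) :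
  equivalence_rel (@isomorphic D).
Proof.
have refl m : isomorphic m m.
  by apply/existsP; exists 1%g; rewrite !perm1 eqxx andbT; apply/andP; split;
    apply/forallP => d; rewrite !perm1.
have sym m1 m2 : isomorphic m1 m2 -> isomorphic m2 m1.
  move=> /existsP[s /and3P[/forallP a /forallP f /eqP r]].
  apply/existsP; exists s^-1%g; apply/and3P; split.
  - by apply/forallP=> d; rewrite -{1}(permKV s d) -(eqP (a _)) permK.
  - by apply/forallP=> d; rewrite -{1}(permKV s d) -(eqP (f _)) permK.
  - by rewrite -r permK.
have trans m1 m2 m3 : isomorphic m1 m2 -> isomorphic m2 m3 -> isomorphic m1 m3.
  move=> /existsP[s /and3P[/forallP a /forallP f /eqP r]].
  move=> /existsP[s' /and3P[/forallP a' /forallP f' /eqP r']].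
  apply/existsP; exists (s * s')%g; apply/and3P; split.
  - by apply/forallP=> d; rewrite !permM (eqP (a _)) a'.
  - by apply/forallP=> d; rewrite !permM (eqP (f _)) f'.
  - by rewrite permM r r'.
move=> x y z; split=> // xy; apply/idP/idP; last exact: trans.
by apply: trans; apply: sym.
Qed.

(* 2n triangles have 6n sides in total. *)
Definition sides (n : nat) := 'I_(6 * n).

Definition labelled_triangulations (n g : nat) :
    {set labelled_map (sides n)} :=
  [set m | [&& is_triangulation m, #|faces m| == 2 * n & has_genus g m]].

(* T(2n, g): rooted triangulations are isomorphism classes of labelled ones. *)
Definition triangulations (n g : nat) : {set {set labelled_map (sides n)}} :=
  equivalence_partition (@isomorphic (sides n)) (labelled_triangulations n g).

Section Probability.
Local Open Scope ring_scope.
Variables (R : realType) (n g : nat).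
Variable ev : labelled_map (sides n) -> sides n -> sides n -> bool.

(* Probability of [ev t x y] for independent uniform oriented edges x, y of a
   representative t of the class C.  The choice of the representative is
   immaterial for events that are invariant under isomorphism. *)
Definition prob_edges (C : {set labelled_map (sides n)}) : R :=
  if [pick t in C] is Some t then
    #|[set e : sides n * sides n | ev t e.1 e.2]|%:R
      / #|{: sides n * sides n}|%:R
  else 0.

(* The class C is itself uniform in T(2n, g).  The value is the junk 0 if
   T(2n, g) is empty. *)
Definition prob_triangulation_edges : R :=
  (\sum_(C in triangulations n g) prob_edges C) / #|triangulations n g|%:R.

End Probability.

(* Main.v *)
(* A side is an oriented edge, and a bud is a vertex of degree 1, that is, a
   fixed point of [turn].  The proof uses two local modifications of
   triangulations which only change the gluing of the sides, and counts
   preimages; it needs no asymptotic enumeration.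

   Many buds.  Gluing together two consecutive sides of a triangle, and their
   former neighbours together, merges the endpoints of the third side and
   creates a bud, without changing the genus.  Since the number of vertices is
   linear in n, so is the number of vertices of bounded degree, and if the
   merge happens at such a vertex then only boundedly many triangulations lead
   to the same result around a given bud.  Hence triangulations with at most c n
   buds form an exponentially small proportion.

   Tentacles.  A bud can be removed and inserted into any other edge without
   affecting distances between the remaining vertices.  If diam < d(x, y) + h,
   move h buds one after the other, the first one to x and each of the others to
   the bud moved just before.  This grows a path of length h at x, whose tip
   belongs to every pair of vertices realising the diameter of the new
   triangulation.  So the new triangulation determines the tip up to two choices,
   and the old one can be recovered from y, the tip and the h places from which
   the buds were taken, i.e. from O(n) (6n)^h possibilities, against
   n^2 (c n)^h choices on the other side.  With h = t log n and t small, such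
   pairs (x, y) are rare. *)
Require Import Defs.
From HB Require Import structures.
From mathcomp Require Import all_boot all_order all_algebra all_fingroup.
From mathcomp Require boolp.
From mathcomp Require Import reals zify ring.
Set Implicit Arguments.
Unset Strict Implicit.
Unset Printing Implicit Defensive.

Local Notation glue := Defs.glue.
Local Notation next := Defs.next.
Local Notation adjacent := Defs.adjacent.
Local Notation root := Defs.root.

(** * Distances and connectivity *)

Lemma porbit_morph (D D' : finType) (f : D -> D') (s : {perm D}) (s' : {perm D'}) :
  (forall x, f (s x) = s' (f x)) ->
  forall x, porbit s' (f x) = [set f y | y in porbit s x].
Proof.
move=> fs x.
have fsX i : (s' ^+ i)%g (f x) = f ((s ^+ i)%g x).
  by elim: i => [|i IH]; rewrite ?expg0 ?perm1 // !expgSr !permM IH fs.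
apply/setP => z; apply/porbitP/imsetP => [[i ->]|[y /porbitP[i ->] ->]].
  by exists ((s ^+ i)%g x); rewrite ?mem_porbit.
by exists i; rewrite fsX.
Qed.

Lemma porbit_step (D : finType) (s : {perm D}) x : porbit s (s x) = porbit s x.
Proof. by rewrite -(porbit_perm s 1 x) expg1. Qed.

Lemma card_porbits_inj (D D' : finType) (f : D -> D') (s : {perm D}) (s' : {perm D'}) :
  injective f -> (forall x, f (s x) = s' (f x)) ->
  #|[set porbit s' (f x) | x in D]| = #|porbits s|.
Proof.
move=> finj fs; rewrite -(card_imset (mem (porbits s)) (imset_inj finj)).
congr #|pred_of_set _|; apply/setP => A; apply/imsetP/imsetP.
  move=> [x _ ->]; exists (porbit s x); first exact: imset_f.
  exact: porbit_morph.
move=> [_ /imsetP[x _ ->] ->]; exists x => //.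
by rewrite (porbit_morph fs).
Qed.

Lemma card_porbits_conj (D D' : finType) (f : D -> D') (s : {perm D}) (s' : {perm D'}) :
  bijective f -> (forall x, f (s x) = s' (f x)) -> #|porbits s'| = #|porbits s|.
Proof.
move=> [g fK gK] fs; rewrite -(card_porbits_inj (can_inj fK) fs).
congr #|pred_of_set _|; apply/setP => A; apply/imsetP/imsetP => -[x _ ->].
  by exists (g x); rewrite ?gK.
by exists (f x).
Qed.

(** Distances are handled on sides, each standing for its starting point: moving inside a vertex is
    free and only crossing an edge costs a step. As [reach_refl] holds for every [k], the number is
    an upper bound on the length, and [vdist] will be the least one. *)
Inductive reach (D : finType) (m : labelled_map D) : nat -> D -> D -> Prop :=
| reach_refl k x : reach m k x x
| reach_start k x y z : reach m k x y -> start m y = start m z -> reach m k x z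
| reach_glue k x y : reach m k x y -> reach m k.+1 x (glue m y).

Section Reach.
Variable D : finType.
Implicit Types m : labelled_map D.

Lemma turnE m x : turn m x = next m (glue m x).
Proof. exact: permM. Qed.

Lemma start_turn m x : start m (turn m x) = start m x.
Proof. exact: porbit_step. Qed.

Lemma start_eq m x y : (start m x == start m y) = (x \in start m y).
Proof. exact: eq_porbit_mem. Qed.

Lemma reach_trans m k l x y z :
  reach m k x y -> reach m l y z -> reach m (k + l) x z.
Proof.
move=> xy yz; elim: yz x k xy => {l y z} [l y|l y z1 z2 _ IH e|l y z _ IH] x k xy.
- elim: xy => {x y k} [k x|k x y z _ IH e|k x y _ IH]; first exact: reach_refl.
    exact: reach_start IH e.
  by rewrite addSn; apply: reach_glue.
- exact: reach_start (IH _ _ xy) e.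
- by rewrite addnS; apply: reach_glue; apply: IH.
Qed.

Lemma reach_same m k x y : start m x = start m y -> reach m k x y.
Proof. exact: reach_start (reach_refl _ _ _). Qed.

Lemma reach_sym m : involutive (glue m) ->
  forall k x y, reach m k x y -> reach m k y x.
Proof.
move=> gK k x y; elim=> {k x y} [k x|k x y z _ IH e|k x y _ IH].
- exact: reach_refl.
- by rewrite -(add0n k); apply: reach_trans IH; apply: reach_same.
rewrite -add1n; apply: reach_trans IH.
by rewrite -{2}(gK y); apply: reach_glue; apply: reach_refl.
Qed.

Lemma reach_walk m k x y : reach m k x y ->
  exists2 j, j <= k & walk (adjacent m) j (start m x) (start m y).
Proof.
elim=> {k x y} [k x|k x y z _ IH e|k x y _ [j jk /existsP[p /andP[pp /eqP lp]]]].
- by exists 0 => //; apply/existsP; exists [tuple] => /=.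
- by rewrite -e.
- exists j.+1 => //; apply/existsP; exists [tuple of rcons p (start m (glue m y))].
  rewrite /= rcons_path pp last_rcons eqxx /= lp andbT.
  by apply/existsP; exists y; rewrite !eqxx.
Qed.

Lemma walk_reach m k x y :
  walk (adjacent m) k (start m x) (start m y) -> reach m k x y.
Proof.
move=> /existsP[[p /= /eqP <-]] {k}.
elim/last_ind: p y => [|p u IH] y.
  by move=> /= /eqP; apply: reach_same.
rewrite rcons_path last_rcons size_rcons => /andP[/andP[pp /existsP[d]]].
move=> /andP[/eqP sd /eqP su] /eqP uy.
apply: (@reach_start _ _ _ _ (glue m d)); last by rewrite su.
by apply/reach_glue/IH; rewrite pp sd eqxx.
Qed.

Lemma gdist_le (V : finType) (adj : rel V) k u v :
  walk adj k u v -> gdist adj u v <= k.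
Proof.
(* Beyond [#|V|] the bound is trivial, since an unsuccessful search returns [#|V|]. *)
move=> w; have [lt|ge] := ltnP k #|V|; last first.
  by rewrite (leq_trans _ ge) // -[X in _ <= X](size_iota 0) find_size.
rewrite leqNgt; apply/negP => h; have := before_find 0 h.
by rewrite nth_iota // add0n w.
Qed.

(** A walk can be shortened to one without repeated vertices, whose length is below [#|V|]; hence
    the search that defines [gdist] succeeds. *)
Lemma gdist_walk (V : finType) (adj : rel V) k u v :
  walk adj k u v -> walk adj (gdist adj u v) u v.
Proof.
move=> /existsP[p /andP[]]; case/shortenP => p' pp' up' _ /eqP lp'.
have lt : size p' < #|V| by have := max_card (mem (u :: p')); rewrite (card_uniqP up').
have w : walk adj (size p') u v.
  by apply/existsP; exists (in_tuple p'); rewrite pp' lp' eqxx.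
have h : has (fun k => walk adj k u v) (iota 0 #|V|).
  by apply/hasP; exists (size p') => //; rewrite mem_iota.
have := nth_find 0 h; rewrite nth_iota ?add0n //.
by rewrite -[X in _ < X](size_iota 0) -has_find.
Qed.

Definition vdist m x y := dist m (start m x) (start m y).

Lemma vdist_le m k x y : reach m k x y -> vdist m x y <= k.
Proof. by move=> /reach_walk[j jk w]; apply: leq_trans jk; apply: gdist_le. Qed.

Lemma vdist_reach m k x y : reach m k x y -> reach m (vdist m x y) x y.
Proof. by move=> /reach_walk[j jk w]; apply: walk_reach; apply: gdist_walk w. Qed.

Lemma vdist_diam m x y : vdist m x y <= diam m.
Proof.
have vx z : start m z \in vertices m by apply: imset_f.
rewrite /diam (bigD1 (start m x)) //= leq_max (bigD1 (start m y)) //=.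
by rewrite leq_max leqnn.
Qed.

Lemma diam_le m k : (forall x y, vdist m x y <= k) -> diam m <= k.
Proof.
move=> h; apply/bigmax_leqP => _ /imsetP[x _ ->].
by apply/bigmax_leqP => _ /imsetP[y _ ->]; apply: h.
Qed.

Definition connected m := forall x y, exists k, reach m k x y.

Lemma reach_next m k x y : involutive (glue m) -> reach m k x y ->
  reach m k.+1 x (next m y).
Proof.
move=> gK xy; apply: (@reach_start _ _ _ _ (glue m y)); first exact: reach_glue.
by rewrite -{2}(gK y) -turnE start_turn.
Qed.

Lemma is_mapP m : reflect
  [/\ involutive (glue m), (forall x, glue m x != x) & connected m] (is_map m).
Proof.
apply: (iffP and3P) => [[/forallP gK /forallP gN tr]|[gK gN cn]].
  have gK' : involutive (glue m) by move=> x; apply/eqP.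
  split=> // x y.
  have [s sG ->] := atransP2 tr (in_setT x) (in_setT y).
  (* The set of sides reachable from [x] is stable under both generators, hence under the group they
     generate. *)
  pose P := [set z | boolp.asbool (exists k, reach m k x z)].
  have stab (t : {perm D}) : (forall z, z \in P -> t z \in P) -> t \in 'N(P | 'P)%g.
    move=> tP; apply/astabsP => z; rewrite /= /aperm.
    apply/idP/idP; last exact: tP.
    move=> tzP; have : z \in porbit t (t z).
      by rewrite -eq_porbit_mem porbit_step.
    by move=> /porbitP[i ->]; elim: i => [|i IH];
      rewrite ?expg0 ?perm1 // expgSr permM tP.
  have sN : s \in 'N(P | 'P)%g; first apply: (subsetP _ _ sG).
    have PE z : reflect (exists k, reach m k x z) (z \in P).
      by rewrite /P inE; apply: boolp.asboolP.
    rewrite gen_subG; apply/subsetP => t /set2P[] ->; apply: stab => z.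
      by move=> /PE[k xz]; apply/PE; exists k.+1; apply: reach_glue.
    by move=> /PE[k xz]; apply/PE; exists k.+1; apply: reach_next.
  have : s x \in P.
    rewrite -apermE (astabs_act _ sN) inE; apply/boolp.asboolP.
    by exists 0; apply: reach_refl.
  by rewrite inE => /boolp.asboolP.
split; [by apply/forallP => x; rewrite gK | exact/forallP |].
set G := << _ >>%g.
apply/imsetP; exists (root m); rewrite ?inE //; apply/setP => y; rewrite inE.
symmetry; have [k] := cn (root m) y; elim=> {k y} [k x|k x y z _ IH e|k x y _ IH].
- exact: orbit_refl.
- have : z \in start m y by rewrite -start_eq e.
  move=> /porbitP[i ->]; rewrite -apermE.
  apply: orbit_trans IH; apply: mem_orbit; rewrite groupX //.
  by rewrite groupM // mem_gen // !inE eqxx ?orbT.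
- rewrite -apermE; apply: orbit_trans IH; apply: mem_orbit.
  by rewrite mem_gen // !inE eqxx.
Qed.

End Reach.

(** Transports paths along a map of sides that is constant on vertices and 1-Lipschitz, within a set
    closed under [glue] and [turn]. With a constant [f] it serves as induction over a connected
    map. *)
Lemma reach_map (D D' : finType) (m : labelled_map D) (m' : labelled_map D')
    (P : pred D) (f : D -> D') :
  (forall x, P x -> P (glue m x)) -> (forall x, P x -> P (turn m x)) ->
  (forall x, P x -> start m' (f (turn m x)) = start m' (f x)) ->
  (forall x, P x -> reach m' 1 (f x) (f (glue m x))) ->
  forall k x y, P x -> reach m k x y -> P y /\ reach m' k (f x) (f y).
Proof.
move=> Pg Pt ft fg k x y Px xy.
elim: xy Px => {k x y} [k x|k x y z _ IH e|k x y _ IH] Px.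
- by split=> //; apply: reach_refl.
- have [Py xy] := IH Px.
  have : z \in start m y by rewrite -start_eq e.
  move=> /porbitP[i ->].
  suff [Pi si] : P ((turn m ^+ i)%g y) /\
      start m' (f ((turn m ^+ i)%g y)) = start m' (f y).
    by split=> //; apply: reach_start xy _.
  elim: i => [|i [Pi si]]; first by rewrite expg0 perm1.
  by rewrite expgSr permM; split; [apply: Pt | rewrite ft].
- have [Py xy] := IH Px; split; first exact: Pg.
  by rewrite -addn1; apply: reach_trans xy (fg _ Py).
Qed.

(** * Rewiring and zipping *)

(* Glues x to y and the former partner of x to the former partner of y.
   Conjugating by a transposition makes this a fixed-point-free involution
   without any side condition. *)
Definition rewire (D : finType) (m : labelled_map D) (x y : D) : labelled_map D :=
  ((glue m ^ tperm (glue m x) y)%g, next m, root m).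

Definition buds (D : finType) (m : labelled_map D) := [set x | turn m x == x].

Section Rewire.
Variable D : finType.
Implicit Types (m : labelled_map D) (x y z : D).

Lemma next_rewire m x y : next (rewire m x y) = next m. Proof. by []. Qed.
Lemma glue_rewire m x y z :
  glue (rewire m x y) z = tperm (glue m x) y (glue m (tperm (glue m x) y z)).
Proof.
have -> : glue (rewire m x y) = (glue m ^ tperm (glue m x) y)%g by [].
by rewrite conjgE tpermV !permM.
Qed.

Lemma rewireK_glue m x y :
  ((glue (rewire m x y)) ^ tperm (glue m x) y)%g = glue m.
Proof.
have -> : glue (rewire m x y) = (glue m ^ tperm (glue m x) y)%g by [].
by rewrite -conjgM tperm2 conjg1.
Qed.

Lemma rewire_invol m x y : involutive (glue m) -> involutive (glue (rewire m x y)).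
Proof. by move=> gK z; rewrite !glue_rewire tpermK gK tpermK. Qed.

Lemma rewire_fpf m x y : (forall z, glue m z != z) ->
  forall z, glue (rewire m x y) z != z.
Proof.
move=> gN z; rewrite glue_rewire; set t := tperm _ _.
by rewrite -{2}(tpermK (glue m x) y z) (inj_eq perm_inj).
Qed.

(** Conjugating [glue] by one transposition multiplies [turn] by two. Each of them merges two cycles
    or splits one, so vertices can be counted with [porbits_mul_tperm]. *)
Lemma turn_rewire m x y : involutive (glue m) ->
  turn (rewire m x y) =
    (tperm (glue m x) y * (tperm x (glue m y) * turn m))%g.
Proof.
move=> gK; apply/permP => z; rewrite [RHS]permM [RHS]permM !turnE glue_rewire next_rewire.
congr (next m _).
set w := tperm _ _ z; have inj := can_inj gK.
case: (tpermP (glue m x) y (glue m w)) => [/inj->|e|n1 n2].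
- by rewrite tpermL gK.
- by rewrite -e gK tpermR.
- rewrite tpermD //; apply/eqP => e; first by apply: n1; rewrite e.
  by apply: n2; rewrite -e gK.
Qed.

Section Values.
Variables (m : labelled_map D) (x y : D).
Hypotheses (gK : involutive (glue m)) (gN : forall z, glue m z != z).
Hypothesis xy : x != y.

Let gxgy : glue m x != glue m y.
Proof. by rewrite (inj_eq perm_inj). Qed.

Lemma glue_rewire1 : glue (rewire m x y) x = y.
Proof. by rewrite glue_rewire (@tpermD _ _ _ x) ?tpermL // eq_sym. Qed.

Lemma glue_rewire2 : glue (rewire m x y) y = x.
Proof. by rewrite glue_rewire tpermR gK tpermD // eq_sym. Qed.

Lemma glue_rewire3 : glue (rewire m x y) (glue m x) = glue m y.
Proof. by rewrite glue_rewire tpermL tpermD // eq_sym. Qed.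

Lemma glue_rewire4 : glue (rewire m x y) (glue m y) = glue m x.
Proof.
by rewrite glue_rewire (@tpermD _ _ _ (glue m y)) ?gK ?tpermR // eq_sym.
Qed.

Lemma glue_rewireD z : z != x -> z != y -> z != glue m x -> z != glue m y ->
  glue (rewire m x y) z = glue m z.
Proof.
move=> zx zy zgx zgy; rewrite glue_rewire (@tpermD _ _ _ z) 1?eq_sym //.
rewrite tpermD // 1?eq_sym ?(inj_eq perm_inj) //.
by apply: contraNneq zgy => <-; rewrite gK.
Qed.

End Values.

(** Whether [z] is a bud depends on [glue m z] only, and a rewiring changes [glue] at no more than
    four sides. The same reason gives the converse bound below. *)
Lemma rewire_buds m x y : involutive (glue m) ->
  buds (rewire m x y) \subset buds m :|: [set x; y; glue m x; glue m y].
Proof.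
move=> gK; apply/subsetP => z zb; rewrite inE.
case: (boolP (z \in [set x; y; glue m x; glue m y])); rewrite ?orbT //.
rewrite !inE !negb_or -!andbA => /and4P[zx zy zgx zgy]; rewrite orbF.
by move: zb; rewrite !inE !turnE (glue_rewireD gK).
Qed.

Lemma card_set4 (a b c d : D) : #|[set a; b; c; d]| <= 4.
Proof.
by rewrite -!setUA !cardsU1 cards1; do 3 case: (_ \notin _).
Qed.

Lemma card_buds_rewire m x y : involutive (glue m) ->
  #|buds (rewire m x y)| <= #|buds m| + 4.
Proof.
move=> gK; apply: leq_trans (subset_leq_card (rewire_buds x y gK)) _.
by rewrite cardsU; apply: leq_trans (leq_subr _ _) _; rewrite leq_add2l card_set4.
Qed.

Lemma buds_rewire m x y : involutive (glue m) ->
  buds m \subset buds (rewire m x y) :|: [set x; y; glue m x; glue m y].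
Proof.
move=> gK; apply/subsetP => z zb; rewrite inE.
case: (boolP (z \in [set x; y; glue m x; glue m y])); rewrite ?orbT //.
rewrite !inE !negb_or -!andbA => /and4P[zx zy zgx zgy]; rewrite orbF.
by move: zb; rewrite !inE !turnE (glue_rewireD gK).
Qed.

Lemma card_buds_rewireV m x y : involutive (glue m) ->
  #|buds m| <= #|buds (rewire m x y)| + 4.
Proof.
move=> gK; apply: leq_trans (subset_leq_card (buds_rewire x y gK)) _.
by rewrite cardsU; apply: leq_trans (leq_subr _ _) _; rewrite leq_add2l card_set4.
Qed.

End Rewire.

Definition linked (D : finType) (m : labelled_map D) x y := exists k, reach m k x y.

Section Linked.
Variable D : finType.
Variable m : labelled_map D.
Hypothesis gK : involutive (glue m).

Lemma linked_refl x : linked m x x.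
Proof. by exists 0; apply: reach_refl. Qed.

Lemma linked_sym x y : linked m x y -> linked m y x.
Proof. by move=> [k xy]; exists k; apply: reach_sym. Qed.

Lemma linked_trans x y z : linked m x y -> linked m y z -> linked m x z.
Proof. by move=> [k xy] [l yz]; exists (k + l); apply: reach_trans xy yz. Qed.

Lemma linked_glue x : linked m x (glue m x).
Proof. by exists 1; apply: reach_glue; apply: reach_refl. Qed.

Lemma linked_next x : linked m x (next m x).
Proof. by exists 1; apply: reach_next => //; apply: reach_refl. Qed.

Lemma linked_start x y : start m x = start m y -> linked m x y.
Proof. by exists 0; apply: reach_same. Qed.

Lemma linked_map (D' : finType) (m' : labelled_map D') (f : D' -> D) :
  (forall x, linked m (f x) (f (glue m' x))) ->
  (forall x, linked m (f x) (f (next m' x))) ->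
  forall x y, linked m' x y -> linked m (f x) (f y).
Proof.
move=> fg fn x y [k]; elim=> {k x y} [k x|k x y z _ IH e|k x y _ IH].
- exact: linked_refl.
- apply: linked_trans IH _.
  have : z \in start m' y by rewrite -start_eq e.
  move=> /porbitP[i ->]; elim: i => [|i IH].
    by rewrite expg0 perm1; apply: linked_refl.
  rewrite expgSr permM turnE; apply: linked_trans IH _.
  by apply: linked_trans (fg _) (fn _).
- exact: linked_trans IH (fg _).
Qed.

End Linked.

Lemma connected_map (D : finType) (m m' : labelled_map D) :
  involutive (glue m') -> connected m ->
  (forall x, linked m' x (glue m x)) -> next m' = next m -> connected m'.
Proof.
move=> gK cn fg en x y.
apply: (@linked_map _ m' _ m id fg _ _ _ (cn x y)) => z.
by rewrite -en; apply: linked_next.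
Qed.

Section Zip.
Variables (D : finType) (m : labelled_map D) (d : D).
Hypotheses (gK : involutive (glue m)) (gN : forall z, glue m z != z).
Hypothesis n3 : forall z, next m (next m (next m z)) = z.
Hypothesis nN : forall z, next m z != z.
Hypothesis cn : connected m.
Let a := next m d.
Let b := next m a.
Hypothesis loopless : start m d != start m a.
Definition zipped := rewire m a b.

Let ab : a != b. Proof. by rewrite eq_sym nN. Qed.

Let nb : next m b = d. Proof. exact: n3. Qed.

Let gab : glue m a != b.
Proof.
apply: contraNneq loopless => e.
by rewrite -(start_turn m a) turnE e nb.
Qed.

Let Q := glue m b.
Let P := glue m a.

Let turnQ : turn m Q = d. Proof. by rewrite turnE gK. Qed.

Lemma zipped_bud : b \in buds zipped.
Proof. by rewrite inE turnE next_rewire glue_rewire2. Qed.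

Lemma zipped_vertices : #|vertices zipped| = #|vertices m|.
Proof.
rewrite /vertices turn_rewire //; set s1 := (tperm a _ * _)%g.
have aQ : a != Q by apply: contraNneq gab => ->; rewrite gK.
(* The first transposition merges the two endpoints of [d], which are distinct by [loopless]. *)
have := porbits_mul_tperm (turn m) a Q.
rewrite /= -/s1 aQ.
have -> : a \notin porbit (turn m) Q.
  apply: contra loopless; rewrite -start_eq => /eqP->.
  by rewrite -turnQ start_turn.
(* The second one splits the bud off, as [b] directly follows [P] in the merged rotation; the two
   changes cancel. *)
have := porbits_mul_tperm s1 P b; rewrite /= gab.
have -> : (P \notin porbit s1 b) = false.
  apply/negbTE; rewrite negbK porbit_sym; have -> : b = s1 P; last first.
    by rewrite -{1}(expg1 s1) mem_porbit.
  rewrite permM tpermD; first by rewrite turnE gK.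
    by rewrite eq_sym gN.
  by rewrite (inj_eq perm_inj) eq_sym.
rewrite addn0. move=> e1 e2. by apply: (@addIn 1); rewrite -e2 -/P e1 -addnA.
Qed.

(* The rotation around the merged vertex follows the old rotation around
   [start m d] until it meets the partner of b: at most deg(start m d)
   candidates for that partner remain once m is forgotten. *)
Lemma zipped_turn : exists2 j, j < #|start m d| & iter j (turn zipped) d = Q.
Proof.
(* The first [i] old steps are followed by at most [i] new ones: either [Q] has been met, or both
   rotations are at the same side, or the old one is at [b], which the new one skips while waiting
   at [P]. *)
have dP : forall i,
    [\/ exists2 j, j <= i & iter j (turn zipped) d = Q,
        exists2 j, j <= i & iter j (turn zipped) d = iter i (turn m) d |
        iter i (turn m) d = b /\ exists2 j, j <= i & iter j (turn zipped) d = P].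
  elim=> [|i [[j ji e]|[j ji e]|[eb [j ji e]]]].
  - by constructor 2; exists 0.
  - by constructor 1; exists j => //; apply: leqW.
  - have [zQ|zQ] := eqVneq (iter i (turn m) d) Q.
      by constructor 1; exists j; [apply: leqW | rewrite e].
    have [zP|zP] := eqVneq (iter i (turn m) d) P.
      constructor 3; split; first by rewrite iterS zP turnE gK.
      by exists j; [apply: leqW | rewrite e].
    constructor 2; exists j.+1 => //; rewrite !iterS e !turnE next_rewire.
    rewrite glue_rewireD //.
    + apply: contraNneq loopless => <-; rewrite -permX.
      by rewrite /start porbit_perm.
    (* A new rotation reaching the fixed point [b] must have started there, but [d] differs from
       [b]. *)
    + apply/eqP => zb; move: e; rewrite zb => e.
      have fixb : iter j (turn zipped) b = b.
        elim: (j) => // l IH; rewrite iterS IH.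
        by have := zipped_bud; rewrite inE => /eqP.
      have : iter j (turn zipped) d = iter j (turn zipped) b by rewrite e fixb.
      rewrite -!permX => /perm_inj db.
      by have := nN b; rewrite nb db eqxx.
  - constructor 2; exists j.+1 => //; rewrite !iterS e eb !turnE next_rewire.
    by rewrite glue_rewire3.
have r0 : 0 < #|start m d| by rewrite lt0n card_porbit_neq0.
(* [Q] is the last side in the old rotation starting at [d]. *)
have eQ : iter #|start m d|.-1 (turn m) d = Q.
  by apply: (@perm_inj _ (turn m)); rewrite turnQ -iterS prednK // iter_porbit.
have [[j ji e]|[j ji e]|[e _]] := dP #|start m d|.-1.
- by exists j => //; rewrite -(prednK r0).
- by exists j; rewrite ?e // -(prednK r0).
- by have := gN b; rewrite -/Q -eQ e eqxx.
Qed.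

Lemma zipped_invol : involutive (glue zipped). Proof. exact: rewire_invol. Qed.

(** Only the gluings of [a] with [P] and of [b] with [Q] are lost. [zipped_turn] links [d], hence
    [b] and [a], to [Q], and [Q] is now glued to [P]. *)
Lemma zipped_connected : connected zipped.
Proof.
have lk x : linked zipped x (next m x) by apply: (@linked_next _ zipped); apply: zipped_invol.
have dQ : linked zipped d Q.
  have [j _ <-] := zipped_turn; apply: linked_start.
  by rewrite -permX /start porbit_perm.
have bQ : linked zipped b Q by apply: linked_trans dQ; rewrite -nb.
have aP : linked zipped a P.
  apply: linked_trans (lk a) _; apply: linked_trans bQ _.
  have <- : glue zipped Q = P by apply: glue_rewire4.
  exact: linked_glue.
apply: (connected_map zipped_invol cn) => // x.
have [->|xa] := eqVneq x a; first exact: aP.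
have [->|xb] := eqVneq x b; first exact: bQ.
have [->|xP] := eqVneq x P; first by rewrite gK; apply: linked_sym aP; apply: zipped_invol.
have [->|xQ] := eqVneq x Q; first by rewrite gK; apply: linked_sym bQ; apply: zipped_invol.
have <- : glue zipped x = glue m x by apply: glue_rewireD.
exact: linked_glue.
Qed.

(** A rewiring is undone by the same conjugation, so the bud and the position of [Q] in the new
    rotation determine the old gluing. *)
Lemma zipped_recover j : iter j (turn zipped) d = Q ->
  glue m = (glue zipped ^ tperm (glue zipped (iter j (turn zipped) d)) b)%g.
Proof.
by move=> ->; rewrite (glue_rewire4 gK gN ab) /zipped rewireK_glue.
Qed.

Lemma zipped_card_buds : #|buds zipped| <= #|buds m| + 4.
Proof. exact: card_buds_rewire. Qed.

End Zip.

(** * Inserting a bud *)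

Lemma porbit_closed (D : finType) (s : {perm D}) (P : pred D) x y :
  (forall z, P z -> P (s z)) -> P x -> y \in porbit s x -> P y.
Proof.
move=> Ps Px /porbitP[i ->]; elim: i => [|i IH]; first by rewrite expg0 perm1.
by rewrite expgSr permM; apply: Ps.
Qed.

(* The six sides of the two triangles around the bud b: the triangle of b has
   two sides glued together, its third side a0 is glued to b0 in the second
   triangle, and the remaining sides b1 and b2 attach it to the rest. *)
Definition gadget (D : finType) (m : labelled_map D) (b : D) : seq D :=
  let a0 := next m b in let a1 := next m a0 in
  let b0 := glue m a0 in let b1 := next m b0 in
  [:: b; a0; a1; b0; b1; next m b1].

Section Gadget.
Variables (D : finType) (m : labelled_map D) (b : D).
Hypotheses (gK : involutive (glue m)) (gN : forall z, glue m z != z).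
Hypothesis n3 : forall z, next m (next m (next m z)) = z.
Hypothesis nN : forall z, next m z != z.
Hypothesis gb : glue m b = next m (next m b).

(** Since [b] is glued to [a1], the side [a0] can only be glued to a side of another triangle; the
    gadget therefore consists of two disjoint faces. *)
Lemma gadget_uniq : uniq (gadget m b).
Proof.
have n2 z : next m (next m z) != z.
  by apply/eqP => e; have := nN z; rewrite -{1}e n3 eqxx.
set a0 := next m b; set a1 := next m a0; set b0 := glue m a0.
have gb' : glue m b = a1 by [].
have e1 : b0 != b by apply: contraNneq (nN a0) => e; rewrite -/a1 -gb' -e gK.
have e2 : b0 != a0 by apply: gN.
have e3 : b0 != a1.
  by apply: contraNneq (nN b) => e; rewrite -/a0 -(gK a0) -/b0 e -gb' gK.
have nA z : (next m z \in [:: b; a0; a1]) = (z \in [:: b; a0; a1]).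
  rewrite !inE; apply/idP/idP.
    move=> /or3P[] /eqP e.
    - by rewrite -(n3 z) e /a1 /a0 eqxx !orbT.
    - by rewrite (perm_inj e) eqxx.
    - by rewrite (perm_inj e) eqxx !orbT.
  by move=> /or3P[] /eqP ->; rewrite /a1 /a0 ?n3 eqxx ?orbT.
have b0A : b0 \notin [:: b; a0; a1] by rewrite !inE (negPf e1) (negPf e2).
rewrite /gadget -/a0 -/a1 -/b0 (cat_uniq [:: b; a0; a1]).
apply/and3P; split.
- by rewrite /= !inE !andbT negb_or (eq_sym b) nN (eq_sym b) n2 (eq_sym a0) nN.
- apply/hasPn => z; rewrite !in_cons in_nil orbF => zs.
  change (z \notin [:: b; a0; a1]).
  by case/or3P: zs => /eqP ->; rewrite ?nA.
- by rewrite /= !inE !andbT negb_or (eq_sym b0) nN (eq_sym b0) n2 (eq_sym _ (next m _)) nN.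
Qed.

End Gadget.

(* In m1 the gadget of b is a separate sphere, and it gets inserted into the edge
   of e.  The deletion of a bud is the same operation read backwards. *)
Section Insert.
Variables (D : finType) (m1 : labelled_map D) (b e : D).
Hypotheses (gK : involutive (glue m1)) (gN : forall z, glue m1 z != z).
Hypothesis n3 : forall z, next m1 (next m1 (next m1 z)) = z.
Hypothesis nN : forall z, next m1 z != z.
Let a0 := next m1 b.
Let a1 := next m1 a0.
Let b0 := glue m1 a0.
Let b1 := next m1 b0.
Let b2 := next m1 b1.
Let G := gadget m1 b.
Hypothesis gb : glue m1 b = a1.
Hypothesis gb1 : glue m1 b1 = b2.
Hypothesis eG : e \notin G.
Let f := glue m1 e.
Let m2 := rewire m1 b2 e.

Let uG : uniq G. Proof. exact: gadget_uniq. Qed.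

Let ne : [/\ [/\ b != a0, b != a1, b != b0, b != b1 & b != b2],
  [/\ a0 != a1, a0 != b0, a0 != b1 & a0 != b2],
  [/\ a1 != b0, a1 != b1 & a1 != b2] & [/\ b0 != b1, b0 != b2 & b1 != b2]].
Proof.
move: uG; rewrite /= !inE !negb_or -/a0 -/a1 -/b0 -/b1 -/b2 !andbT.
by move=> /and5P[/and5P[-> -> -> -> ->] /and4P[-> -> -> ->] /and3P[-> -> ->] /andP[-> ->] ->].
Qed.

Let ga1 : glue m1 a1 = b. Proof. by rewrite -gb gK. Qed.
Let gb0 : glue m1 b0 = a0. Proof. by rewrite /b0 gK. Qed.
Let gb2 : glue m1 b2 = b1. Proof. by rewrite -gb1 gK. Qed.
Let nb2 : next m1 b2 = b0. Proof. exact: n3. Qed.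
Let na1 : next m1 a1 = b. Proof. exact: n3. Qed.

Let GP z : reflect (z = b \/ z = a0 \/ z = a1 \/ z = b0 \/ z = b1 \/ z = b2) (z \in G).
Proof.
rewrite !inE -/a0 -/a1 -/b0 -/b1 -/b2; apply: (iffP idP).
  by move=> /or4P[||| /or3P[]] /eqP; intuition.
by case=> [|[|[|[|[|]]]]] ->; rewrite eqxx ?orbT.
Qed.

Let glueG z : z \in G -> glue m1 z \in G.
Proof.
by move=> /GP[|[|[|[|[|]]]]] ->; apply/GP; rewrite ?gb ?ga1 ?gb0 ?gb1 ?gb2; intuition.
Qed.

Let nextG z : z \in G -> next m1 z \in G.
Proof.
by move=> /GP[|[|[|[|[|]]]]] ->; apply/GP; rewrite ?na1 ?nb2 -/a0 -/a1 -/b1 -/b2; intuition.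
Qed.

Let glueO z : z \notin G -> glue m1 z \notin G.
Proof. by apply: contra => /glueG; rewrite gK. Qed.

Let nextO z : z \notin G -> next m1 z \notin G.
Proof. by apply: contra => /nextG/nextG; rewrite n3. Qed.

Let fO : f \notin G. Proof. exact: glueO. Qed.

Let b2e : b2 != e.
Proof. by apply: contraNneq eG => <-; apply/GP; intuition. Qed.

Let g2b2 : glue m2 b2 = e. Proof. exact: glue_rewire1. Qed.
Let g2e : glue m2 e = b2. Proof. exact: glue_rewire2. Qed.
Let g2b1 : glue m2 b1 = f. Proof. by rewrite -gb2; apply: glue_rewire3. Qed.
Let g2f : glue m2 f = b1. Proof. by rewrite -gb2; apply: glue_rewire4. Qed.

Let g2D z : z != e -> z != f -> z != b1 -> z != b2 -> glue m2 z = glue m1 z.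
Proof. by move=> ze zf zb1 zb2; apply: glue_rewireD; rewrite ?gb2. Qed.

Let neG z : z \in G -> (z != e) && (z != f).
Proof.
by move=> zG; apply/andP; split; apply: contraTneq zG => ->.
Qed.

Let g2G z : z \in G -> z != b1 -> z != b2 -> glue m2 z = glue m1 z.
Proof. by move=> /neG/andP[ze zf] zb1 zb2; apply: g2D. Qed.

Let bG : b \in G. Proof. by apply/GP; intuition. Qed.
Let a0G : a0 \in G. Proof. by apply/GP; intuition. Qed.
Let a1G : a1 \in G. Proof. by apply/GP; intuition. Qed.
Let b0G : b0 \in G. Proof. by apply/GP; intuition. Qed.

Let g2b : glue m2 b = a1. Proof. by case: ne => [[]] *; rewrite g2G. Qed.
Let g2a0 : glue m2 a0 = b0. Proof. by case: ne => _ [] *; rewrite g2G. Qed.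
Let g2a1 : glue m2 a1 = b. Proof. by case: ne => _ _ [] *; rewrite g2G. Qed.
Let g2b0 : glue m2 b0 = a0. Proof. by case: ne => _ _ _ [] *; rewrite g2G. Qed.

Let g2O z : z \notin G -> z != e -> z != f -> glue m2 z = glue m1 z.
Proof.
by move=> zG ze zf; apply: g2D => //; apply: contraNneq zG => ->; apply/GP; intuition.
Qed.

Let n2 z : next m2 z = next m1 z. Proof. by []. Qed.

Lemma insert_bud : b \in buds m2.
Proof. by rewrite inE turnE n2 g2b na1. Qed.

Let t2b : turn m2 b = b. Proof. by apply/eqP; have := insert_bud; rewrite inE. Qed.

Let sb0 : start m2 b0 = start m2 e.
Proof. by rewrite -(start_turn m2 e) turnE g2e n2 nb2. Qed.
Let sa1 : start m2 a1 = start m2 e.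
Proof. by rewrite -sb0 -(start_turn m2 b0) turnE g2b0. Qed.
Let sa0 : start m2 a0 = start m2 e.
Proof. by rewrite -sa1 -(start_turn m2 a1) turnE g2a1. Qed.
Let sb1 : start m2 b1 = start m2 e.
Proof. by rewrite -sa0 -(start_turn m2 a0) turnE g2a0. Qed.
Let sb2 : start m2 b2 = start m2 f.
Proof. by rewrite -(start_turn m2 f) turnE g2f. Qed.

(* Collapses the gadget onto the edge of e, by a 1-Lipschitz map. *)
Definition retract z :=
  if z \in [:: b; a0; a1; b0; b1] then e else if z == b2 then f else z.

Lemma retractO z : z \notin G -> retract z = z.
Proof.
move=> zG; rewrite /retract; case: ifP => [h|_].
  case/GP: zG; move: h; rewrite !inE => /or4P[||| /orP[]] /eqP ->; intuition.
by case: eqP => // h; case/GP: zG; intuition.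
Qed.

Let rb : retract b = e. Proof. by rewrite /retract inE eqxx. Qed.
Let ra0 : retract a0 = e. Proof. by rewrite /retract !inE eqxx ?orbT. Qed.
Let ra1 : retract a1 = e. Proof. by rewrite /retract !inE eqxx ?orbT. Qed.
Let rb0 : retract b0 = e. Proof. by rewrite /retract !inE eqxx ?orbT. Qed.
Let rb1 : retract b1 = e. Proof. by rewrite /retract !inE eqxx ?orbT. Qed.
Let rb2 : retract b2 = f.
Proof.
case: ne => [[_ _ _ _ e1] [_ _ _ e2] [_ _ e3] [_ e4 e5]].
rewrite /retract !inE !(eq_sym b2) (negPf e1) (negPf e2) (negPf e3) (negPf e4).
by rewrite (negPf e5) eqxx.
Qed.
Let re : retract e = e. Proof. exact: retractO. Qed.
Let rf : retract f = f. Proof. exact: retractO. Qed.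

Lemma retract_notin z : retract z \notin G.
Proof.
have [zG|zG] := boolP (z \in G); last by rewrite retractO.
by case/GP: zG => [|[|[|[|[|]]]]] ->; rewrite ?rb ?ra0 ?ra1 ?rb0 ?rb1 ?rb2.
Qed.

Lemma start_retract z : z != b -> start m2 (retract z) = start m2 z.
Proof.
have [zG|zG] := boolP (z \in G); last by rewrite retractO.
by case/GP: zG => [|[|[|[|[|]]]]] ->;
  rewrite ?eqxx ?ra0 ?ra1 ?rb0 ?rb1 ?rb2 ?sa0 ?sa1 ?sb0 ?sb1 ?sb2.
Qed.

Let start_retract_turn z : start m1 (retract (turn m2 z)) = start m1 (retract z).
Proof.
rewrite turnE n2.
have [zG|zG] := boolP (z \in G).
  case/GP: zG => [|[|[|[|[|]]]]] ->.
  - by rewrite g2b na1.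
  - by rewrite g2a0 -/b1 rb1 ra0.
  - by rewrite g2a1 -/a0 ra0 ra1.
  - by rewrite g2b0 -/a1 rb0 ra1.
  - by rewrite g2b1 rb1 retractO ?nextO // -turnE start_turn.
  - by rewrite g2b2 rb2 retractO ?nextO // -(start_turn m1 f) turnE gK.
have [->|ze] := eqVneq z e; first by rewrite g2e nb2 rb0 re.
have [->|zf] := eqVneq z f; first by rewrite g2f -/b2 rb2 rf.
by rewrite g2O // !retractO ?nextO ?glueO // -turnE start_turn.
Qed.

Let reach_retract_glue z : reach m1 1 (retract z) (retract (glue m2 z)).
Proof.
have ef : reach m1 1 e f by apply/reach_glue/reach_refl.
have fe : reach m1 1 f e by rewrite -[e in reach _ _ _ e]gK; apply/reach_glue/reach_refl.
have [zG|zG] := boolP (z \in G).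
  case/GP: zG => [|[|[|[|[|]]]]] ->;
  by rewrite ?g2b ?g2a0 ?g2a1 ?g2b0 ?g2b1 ?g2b2 ?rb ?ra0 ?ra1 ?rb0 ?rb1 ?rb2 ?re ?rf //;
     apply: reach_refl.
have [->|ze] := eqVneq z e; first by rewrite g2e rb2 re.
have [->|zf] := eqVneq z f; first by rewrite g2f rb1 rf.
by rewrite g2O // !retractO ?glueO //; apply/reach_glue/reach_refl.
Qed.

Lemma reach_retract k x y : reach m2 k x y -> reach m1 k (retract x) (retract y).
Proof.
move=> xy; suff [] : xpredT y /\ reach m1 k (retract x) (retract y) by [].
by apply: reach_map xy.
Qed.

(** Together with [reach_retract], this makes distances between sides outside the gadget the same
    before and after the insertion. *)
Lemma reach_insert k x y : x \notin G -> reach m1 k x y ->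
  y \notin G /\ reach m2 k x y.
Proof.
apply: (@reach_map _ _ m1 m2 (fun z => z \notin G) id) => z zG //.
- exact: glueO.
- by rewrite turnE; apply/nextO/glueO.
- have [->|ze] := eqVneq z e.
    by rewrite turnE -sb1 -(start_turn m2 b1) turnE g2b1.
  have [->|zf] := eqVneq z f.
    by rewrite turnE gK -sb2 -(start_turn m2 b2) turnE g2b2.
  by rewrite -(start_turn m2 z) !turnE g2O.
(* The edge of [e] is replaced by the one from [e] to [b2], and [b2] starts where [f] does. *)
- have [->|ze] := eqVneq z e.
    apply: reach_start sb2; rewrite -g2e; exact/reach_glue/reach_refl.
  have [->|zf] := eqVneq z f.
    by rewrite gK; apply: reach_start sb1; rewrite -g2f; exact/reach_glue/reach_refl.
  by rewrite -g2O //; apply/reach_glue/reach_refl.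
Qed.

Lemma start_insert_bud z : start m2 z = start m2 b -> z = b.
Proof.
move/eqP; rewrite start_eq => zb; apply/eqP.
by apply: (@porbit_closed _ (turn m2) (pred1 b) b z _ _ zb) => //= x /eqP ->; rewrite t2b.
Qed.

(** The only edge at the bud leads to the starting point of [e], so a path leaving the bud spends
    one step before it projects to a path from [e]. *)
Lemma reach_insert_bud k z : reach m2 k b z ->
  z = b \/ exists2 j, k = j.+1 & reach m1 j e (retract z).
Proof.
move=> bz; have [x xb bz'] : exists2 x, x = b & reach m2 k x z by exists b.
elim: bz' xb => {k x z bz} [k x|k x y z xy IH s|k x y _ IH] xb.
- by left.
- have [yb|[j -> r]] := IH xb.
    by left; apply: start_insert_bud; rewrite -s yb.
  right; exists j => //; apply: reach_start r _.
  have : z \in porbit (turn m2) y by rewrite -start_eq s.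
  move=> zy; symmetry; apply/eqP.
  apply: (@porbit_closed _ (turn m2)
    [pred z | start m1 (retract z) == start m1 (retract y)] y z _ _ zy) => //=.
  by move=> u /eqP <-; rewrite start_retract_turn.
- have [->|[j -> r]] := IH xb.
    by right; exists k => //; rewrite g2b ra1; apply: reach_refl.
  by right; exists j.+1 => //; rewrite -addn1; apply: reach_trans r (reach_retract_glue _).
Qed.

(** Both transpositions merge cycles: two of the three vertices of the separate sphere are
    identified with the endpoints of [e], and the third one is the bud. *)
Lemma insert_vertices : #|vertices m2| + 2 = #|vertices m1|.
Proof.
rewrite /vertices turn_rewire // gb2 -/f; set s1 := (tperm b2 f * _)%g.
have := porbits_mul_tperm (turn m1) b2 f; rewrite /= -/s1.
have -> : b2 \notin porbit (turn m1) f.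
  apply/negP => /(porbit_closed (P := fun z => z \notin G)) h.
  have : b2 \notin G by apply: h => // z zG; rewrite turnE; apply/nextO/glueO.
  by case/GP; intuition.
have -> : b2 != f by apply: contraNneq fO => <-; apply/GP; intuition.
have := porbits_mul_tperm s1 b1 e; rewrite /=.
have -> : b1 \notin porbit s1 e.
  (* After the first merge, the cycle of [b1] is still a vertex of the separate sphere, made of
     these four sides. *)
  rewrite porbit_sym; apply/negP => eb.
  have : e \in [:: b1; b0; a1; a0].
    apply: (porbit_closed (P := fun z => z \in [:: b1; b0; a1; a0])) eb;
      last by rewrite inE eqxx.
    case: ne => [_ [_ _ _ e2] [_ _ e3] [_ e4 e5]] z.
    have tD u : u \in G -> u != b2 -> s1 u = turn m1 u.
      move=> /neG/andP[_ uf] ub; rewrite permM tpermD // eq_sym //.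
    rewrite !inE => /or4P[] /eqP ->; rewrite tD // ?turnE ?gb1 ?nb2 ?gb0 ?ga1 -/b0 -/b1 -/a0 -/a1 ?eqxx ?orbT //.
    all: try by apply/GP; intuition.
  rewrite !inE => /or4P[] /eqP e'; case/negP: eG; rewrite e'; apply/GP; intuition.
have -> : b1 != e by apply: contraNneq eG => <-; apply/GP; intuition.
rewrite !(addn1, doubleS, double0) /= => e1 e2.
by apply: succn_inj; rewrite -e2 e1 addn2.
Qed.

(** The implication from right to left applies when a bud has been cut out, the other one when it is
    put back elsewhere. *)
Lemma insert_connected :
  (forall x y, x \notin G -> y \notin G -> linked m1 x y) <-> connected m2.
Proof.
have gK2 : involutive (glue m2) by apply: rewire_invol.
split=> [cn x y|cn x y xG yG].
  have lr z : linked m2 z (retract z).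
    have [->|zb] := eqVneq z b; last by apply: linked_start; rewrite start_retract.
    rewrite rb; apply: (@linked_trans _ _ _ a1); last exact: linked_start.
    by rewrite -g2b; apply: linked_glue.
  apply: linked_trans (lr x) _; apply: linked_trans (linked_sym gK2 (lr y)).
  have [k r] := cn _ _ (retract_notin x) (retract_notin y).
  by exists k; have [] := reach_insert (retract_notin x) r.
have [k r] := cn x y; exists k.
by rewrite -(retractO xG) -(retractO yG); apply: reach_retract.
Qed.

End Insert.

(** * Transplanting a bud *)

(** This is the side [b1] of the gadget; [next] of it is [b2]. *)
Definition base_side (D : finType) (m : labelled_map D) (b : D) :=
  next m (glue m (next m b)).

(** Gluing [b1] to [b2] cuts the gadget off as a separate sphere, and the gap closes because their
    former partners get glued together. *)
Definition close_gadget (D : finType) (m : labelled_map D) (b : D) :=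
  rewire m (base_side m b) (next m (base_side m b)).

Definition transplant (D : finType) (m : labelled_map D) (b e : D) :=
  rewire (close_gadget m b) (next m (base_side m b)) e.

Section Move.
Variables (D : finType) (m : labelled_map D) (b e : D).
Hypotheses (gK : involutive (glue m)) (gN : forall z, glue m z != z).
Hypothesis n3 : forall z, next m (next m (next m z)) = z.
Hypothesis nN : forall z, next m z != z.
Hypothesis cn : connected m.
Hypothesis D6 : 6 < #|D|.
Hypothesis bb : b \in buds m.
Hypothesis eG : e \notin gadget m b.
Let a0 := next m b.
Let a1 := next m a0.
Let b0 := glue m a0.
Let b1 := next m b0.
Let b2 := next m b1.
Let G := gadget m b.
Let q := glue m b2.
Let m1 := close_gadget m b.
Let m2 := transplant m b e.

Let gb : glue m b = a1.
Proof.
move: bb; rewrite inE turnE => /eqP e1.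
by rewrite -[LHS]n3 e1.
Qed.

Let uG : uniq G. Proof. exact: gadget_uniq. Qed.

Let ne : [/\ [/\ b != a0, b != a1, b != b0, b != b1 & b != b2],
  [/\ a0 != a1, a0 != b0, a0 != b1 & a0 != b2],
  [/\ a1 != b0, a1 != b1 & a1 != b2] & [/\ b0 != b1, b0 != b2 & b1 != b2]].
Proof.
move: uG; rewrite /= !inE !negb_or -/a0 -/a1 -/b0 -/b1 -/b2 !andbT.
by move=> /and5P[/and5P[-> -> -> -> ->] /and4P[-> -> -> ->] /and3P[-> -> ->] /andP[-> ->] ->].
Qed.

Let GP z : reflect (z = b \/ z = a0 \/ z = a1 \/ z = b0 \/ z = b1 \/ z = b2) (z \in G).
Proof.
rewrite !inE -/a0 -/a1 -/b0 -/b1 -/b2; apply: (iffP idP).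
  by move=> /or4P[||| /or3P[]] /eqP; intuition.
by case=> [|[|[|[|[|]]]]] ->; rewrite eqxx ?orbT.
Qed.

Let ga1 : glue m a1 = b. Proof. by rewrite -gb gK. Qed.
Let gb0 : glue m b0 = a0. Proof. by rewrite /b0 gK. Qed.
Let nb2 : next m b2 = b0. Proof. exact: n3. Qed.
Let na1 : next m a1 = b. Proof. exact: n3. Qed.

Let gb1 : glue m b1 != b2.
Proof.
apply/eqP => e1; have e2 : glue m b2 = b1 by rewrite -e1 gK.
(* Otherwise the gadget would be closed under both permutations and thus be the whole connected map,
   which has more than six sides. *)
suff GT z : z \in G.
  have := card_size G; rewrite leqNgt => /negP[]; apply: leq_trans D6 _.
  by rewrite subset_leq_card //; apply/subsetP => z _; apply: GT.
have [k] := cn b z; suff : b \in G.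
  move=> bG /(reach_map (P := [in G]) (m' := m) (f := fun=> b)) h.
  apply: (proj1 (h _ _ _ _ bG)) => //.
  - by move=> u /GP[|[|[|[|[|]]]]] ->; apply/GP;
      rewrite ?gb ?ga1 ?gb0 ?e1 ?e2; intuition.
  - by move=> u /GP[|[|[|[|[|]]]]] ->; apply/GP;
      rewrite turnE ?gb ?ga1 ?gb0 ?e1 ?e2 ?na1 ?nb2 -/a0 -/a1 -/b1 -/b2; intuition.
  - by move=> u _; apply: reach_refl.
by apply/GP; intuition.
Qed.

Let m1D z : z != b1 -> z != b2 -> z != glue m b1 -> z != glue m b2 ->
  glue m1 z = glue m z.
Proof. exact: glue_rewireD. Qed.

Let qG : q \notin G.
Proof.
rewrite /q; case: ne => [[_ _ _ n1 n2] [_ _ n3' n4] [_ n5 n6] [n7 n8 n9]].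
apply/GP => -[|[|[|[|[|]]]]] /(congr1 (glue m)); rewrite gK ?gb ?ga1 ?gb0 => e1.
- by rewrite e1 eqxx in n6.
- by move: n8; rewrite e1 eqxx.
- by rewrite e1 eqxx in n2.
- by rewrite e1 eqxx in n4.
- by move: gb1; rewrite -e1 eqxx.
- by have := gN b2; rewrite -e1 eqxx.
Qed.

Let pG : glue m b1 \notin G.
Proof.
rewrite /q; case: ne => [[_ _ _ n1 n2] [_ _ n3' n4] [_ n5 n6] [n7 n8 n9]].
apply/GP => -[|[|[|[|[|]]]]] /(congr1 (glue m)); rewrite gK ?gb ?ga1 ?gb0 => e1.
- by rewrite e1 eqxx in n5.
- by move: n7; rewrite e1 eqxx.
- by rewrite e1 eqxx in n1.
- by rewrite e1 eqxx in n3'.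
- by have := gN b1; rewrite -e1 eqxx.
- by move: gb1; rewrite e1 gK eqxx.
Qed.

Let m1D' z : z != b1 -> z != b2 -> z != glue m b1 -> z != q ->
  glue m1 z = glue m z.
Proof. exact: m1D. Qed.

Let gK1 : involutive (glue m1). Proof. exact: rewire_invol. Qed.
Let gN1 z : glue m1 z != z. Proof. exact: rewire_fpf. Qed.

Let b12 : b1 != b2. Proof. by case: ne => _ _ _ []. Qed.

Let m1b1 : glue m1 b1 = b2. Proof. exact: glue_rewire1. Qed.
Let m1b2 : glue m1 b2 = b1. Proof. exact: glue_rewire2. Qed.
Let m1p : glue m1 (glue m b1) = q. Proof. exact: glue_rewire3. Qed.
Let m1q : glue m1 q = glue m b1. Proof. exact: glue_rewire4. Qed.

Let m1G z : z \in G -> z != b1 -> z != b2 -> glue m1 z = glue m z.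
Proof.
by move=> zG zb1 zb2; apply: m1D' => //; apply: contraTneq zG => ->.
Qed.

Let m1b : glue m1 b = next m1 (next m1 b).
Proof.
change (glue m1 b = a1); case: ne => [[_ _ _ i1 i2] _ _ _].
by rewrite m1G //; apply/GP; intuition.
Qed.

Let m1a0 : glue m1 a0 = b0.
Proof.
case: ne => [_ [_ _ i1 i2] _ _].
by rewrite m1G //; apply/GP; intuition.
Qed.

Lemma gadget_close : gadget m1 b = G.
Proof. by rewrite /gadget -/a0 m1a0. Qed.

Let m1b1' : glue m1 (next m1 (glue m1 (next m1 b))) =
  next m1 (next m1 (glue m1 (next m1 b))).
Proof. by rewrite -/a0 m1a0. Qed.

Let eG1 : e \notin gadget m1 b. Proof. by rewrite gadget_close. Qed.
Let qG1 : q \notin gadget m1 b. Proof. by rewrite gadget_close. Qed.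

Let m2E : m2 = rewire m1 (next m1 (next m1 (glue m1 (next m1 b)))) e.
Proof. by rewrite -/a0 m1a0. Qed.

(** The original map is itself an insertion of the gadget, into the edge of [q]. Every fact about
    insertions thus applies to the removal of a bud. *)
Let mE : glue m =1 glue (rewire m1 (next m1 (next m1 (glue m1 (next m1 b)))) q).
Proof.
have qb2 : b2 != q by apply: contraNneq qG => <-; apply/GP; intuition.
move=> z; rewrite -/a0 m1a0.
have [->|z1] := eqVneq z b2; first by rewrite glue_rewire1.
have [->|z2] := eqVneq z q; first by rewrite glue_rewire2 // /q gK.
have [->|z3] := eqVneq z b1; first by rewrite -{2}m1b2 glue_rewire3 // m1q.
have [->|z4] := eqVneq z (glue m b1).
  by rewrite -{2}m1q glue_rewire4 // m1b2 gK.
by rewrite glue_rewireD // ?m1b2 ?m1q // m1D'.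
Qed.

Let mE' : m = rewire m1 (next m1 (next m1 (glue m1 (next m1 b)))) q.
Proof.
have /permP e1 := mE.
have {1}-> : m = (glue m, next m, root m) by case: (m) => [[]].
by rewrite e1.
Qed.

Lemma transplant_vertices : #|vertices m2| = #|vertices m|.
Proof.
apply: (@addIn 2); rewrite m2E insert_vertices // [in RHS]mE'.
by rewrite insert_vertices.
Qed.

Let linked_close x y : x \notin G -> y \notin G -> linked m1 x y.
Proof.
rewrite -gadget_close; apply: (proj2 (insert_connected gK1 gN1 n3 nN m1b m1b1' qG1)).
by rewrite -mE'.
Qed.

Lemma transplant_connected : connected m2.
Proof.
rewrite m2E; apply: (proj1 (insert_connected gK1 gN1 n3 nN m1b m1b1' eG1)).
by rewrite gadget_close; apply: linked_close.
Qed.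

Let reach_close k x y : x \notin G -> y \notin G -> reach m k x y <-> reach m1 k x y.
Proof.
rewrite -gadget_close => xG yG; rewrite {1}mE'; split=> [|r].
  move=> /(reach_retract gK1 gN1 n3 nN m1b m1b1' qG1).
  by rewrite !retractO.
by have [] := reach_insert gK1 gN1 n3 nN m1b m1b1' qG1 xG r.
Qed.

Let reach_move k x y : x \notin G -> y \notin G -> reach m2 k x y <-> reach m1 k x y.
Proof.
rewrite -gadget_close => xG yG; rewrite {1}m2E; split=> [|r].
  move=> /(reach_retract gK1 gN1 n3 nN m1b m1b1' eG1).
  by rewrite !retractO.
by have [] := reach_insert gK1 gN1 n3 nN m1b m1b1' eG1 xG r.
Qed.

Lemma transplant_vdist x y : x \notin G -> y \notin G -> vdist m2 x y = vdist m x y.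
Proof.
move=> xG yG; apply/eqP; rewrite eqn_leq; apply/andP; split.
  have [k /vdist_reach r] := cn x y; apply: vdist_le.
  by apply/reach_move => //; apply/reach_close.
have [k /vdist_reach r] := transplant_connected x y; apply: vdist_le.
by apply/reach_close => //; apply/reach_move.
Qed.

Let r z := retract m1 b e z.

Let rG z : r z \notin G.
Proof. by rewrite -gadget_close; apply: retract_notin. Qed.

Let start_r z : z != b -> start m2 (r z) = start m2 z.
Proof. by rewrite m2E; apply: start_retract. Qed.

Let vdist_tip z : z != b -> vdist m e (r z) < vdist m2 b z.
Proof.
move=> zb; have [k /vdist_reach] := transplant_connected b z.
rewrite {1}m2E => /(reach_insert_bud gK1 gN1 n3 nN m1b m1b1' eG1)[zb'|[j -> rj]].
  by rewrite zb' eqxx in zb.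
by rewrite ltnS; apply: vdist_le; apply/reach_close.
Qed.

(* The invariant of the growth of a tentacle with tip e, when h buds remain to be
   added.  For h = 0 it forces e to be an endpoint of any diametral pair, since
   d(e, y) is itself at most the diameter. *)
Definition tip_dominates (h : nat) (m : labelled_map D) (e y : D) :=
  forall u v, u != e -> v != e ->
  [\/ vdist m u v < vdist m e y + h, vdist m u v < vdist m e v | vdist m u v < vdist m e u].

(** The new tip is at least one step farther than [e] from everything else, while other distances
    are those of the retracted sides. The gain in the distance from the tip to [y] pays for the
    decrease of [h]. *)
Lemma transplant_tip_dominates h y : y \notin G ->
  tip_dominates h.+1 m e y -> tip_dominates h m2 b y.
Proof.
move=> yG dom u v ub vb.
have ruv : vdist m2 u v = vdist m (r u) (r v).
  by rewrite -transplant_vdist // /vdist !start_r.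
have yb : y != b by apply: contraNneq yG => ->; apply/GP; intuition.
have ry : r y = y by apply: retractO; rewrite // gadget_close.
have ddy := vdist_tip yb; rewrite ry in ddy.
have sym x z : vdist m x z = vdist m z x.
  apply/eqP; rewrite eqn_leq; apply/andP; split; apply: vdist_le;
  apply: reach_sym => //; [have [k] := cn z x | have [k] := cn x z]; exact: vdist_reach.
rewrite ruv.
have [rue|rue] := eqVneq (r u) e; first by constructor 2; rewrite rue; apply: vdist_tip.
have [rve|rve] := eqVneq (r v) e.
  by constructor 3; rewrite rve sym; apply: vdist_tip.
have [lt|lt|lt] := dom _ _ rue rve.
- by constructor 1; apply: leq_trans lt _; rewrite addnS -addSn leq_add2r.
- by constructor 2; apply: ltn_trans lt _; apply: vdist_tip.
- by constructor 3; apply: ltn_trans lt _; apply: vdist_tip.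
Qed.

Lemma transplant_card_buds : #|buds m| <= #|buds m2| + 8.
Proof.
apply: leq_trans (card_buds_rewireV _ _ gK) _.
by rewrite -[8]/(4 + 4) addnA leq_add2r; apply: card_buds_rewireV.
Qed.

Lemma transplant_base_side : base_side m2 b = b1.
Proof.
rewrite /base_side m2E next_rewire; congr (next m _).
rewrite -/a0 m1a0; case: ne => [_ [_ n1 n2' n4] _ [_ _ _]].
have a0e : a0 != e by apply: contraNneq eG => <-; apply/GP; intuition.
rewrite glue_rewireD ?m1b2 ?m1a0 //; apply: contraNneq eG => /(congr1 (glue m1)).
by rewrite m1a0 gK1 => <-; apply/GP; intuition.
Qed.

Lemma transplant_end : glue m2 b2 = e.
Proof.
rewrite m2E -/a0 m1a0; apply: glue_rewire1 => //.
by apply: contraNneq eG => <-; apply/GP; intuition.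
Qed.

(** By the two preceding lemmas, [b1], [b2] and [e] can be read off the new map and [b]. The former
    partner of [b1], where the bud came from, is the only other datum. *)
Lemma transplant_recover :
  glue m = ((glue m2 ^ tperm b1 e) ^ tperm (glue m b1) b2)%g.
Proof.
have -> : (glue m2 ^ tperm b1 e)%g = glue m1 by rewrite -m1b2; exact: rewireK_glue.
by symmetry; exact: rewireK_glue.
Qed.

End Move.

(** * Triangulations with few buds *)

Lemma labelled_map_eq (D : finType) (m m' : labelled_map D) :
  glue m = glue m' -> next m = next m' -> root m = root m' -> m = m'.
Proof.
case: m m' => [[a p] r] [[a' p'] r'].
by rewrite /Defs.glue /Defs.next /Defs.root /= => -> -> ->.
Qed.

Section LabelledTriangulations.
Variables n g : nat.
Notation D := (sides n).
Notation LT := (labelled_triangulations n g).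
Implicit Type m : labelled_map D.

Lemma face_card3 (m : labelled_map D) : is_triangulation m ->
  (forall z, next m (next m (next m z)) = z) /\ (forall z, next m z != z).
Proof.
move=> /andP[_ /forall_inP f3].
have c3 z : #|porbit (next m) z| = 3 by apply/eqP/f3/imset_f.
split=> z; first by have := iter_porbit (next m) z; rewrite c3.
by apply/eqP => e; have := uniq_traject_porbit (next m) z; rewrite c3 /= e !inE eqxx.
Qed.

Lemma labelled_triangulationP m : m \in LT ->
  [/\ involutive (glue m), (forall z, glue m z != z),
      (forall z, next m (next m (next m z)) = z), (forall z, next m z != z) &
      connected m].
Proof.
rewrite inE => /and3P[mt _ _]; have [n3 nN] := face_card3 mt.
by move: mt => /andP[/is_mapP[]].
Qed.

Lemma card_edges_rewire (D' : finType) (m : labelled_map D') x y :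
  #|edges (rewire m x y)| = #|edges m|.
Proof.
apply: (@card_porbits_conj _ _ (tperm (glue m x) y)).
  by exists (tperm (glue m x) y); apply: tpermK.
by move=> z; rewrite glue_rewire tpermK.
Qed.

Lemma labelled_triangulation_glue m m' : m \in LT -> next m' = next m -> #|edges m'| = #|edges m| ->
  #|vertices m'| = #|vertices m| -> involutive (glue m') ->
  (forall z, glue m' z != z) -> connected m' -> m' \in LT.
Proof.
rewrite !inE => /and3P[/andP[_ f3] f2 ge] en ee ev gK gN cn.
have ef : faces m' = faces m by rewrite /faces en.
apply/and3P; split.
- by apply/andP; split; [exact/is_mapP | rewrite ef].
- by rewrite ef.
- by move: ge; rewrite /has_genus /euler_char ev ee ef.
Qed.

Lemma card_pairs (A B : finType) (P : A -> B -> bool) :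
  #|[set p : A * B | P p.1 p.2]| = \sum_a #|[set b | P a b]|.
Proof.
rewrite -sum1_card (eq_bigl (fun p => P p.1 p.2)); last by move=> p; rewrite inE.
rewrite -(pair_big_dep xpredT P (fun _ _ => 1)) /=.
by apply: eq_bigr => a _; rewrite -sum1_card; apply: eq_bigl => b; rewrite inE.
Qed.

Lemma card_pairs_le (A B : finType) (S : {set A}) (P : A -> B -> bool) k :
  (forall a, a \in S -> #|[set b | P a b]| <= k) ->
  #|[set p : A * B | (p.1 \in S) && P p.1 p.2]| <= #|S| * k.
Proof.
move=> h; rewrite (card_pairs (fun a b => (a \in S) && P a b)) -sum_nat_const.
rewrite [leqRHS]big_mkcond; apply: leq_sum => a _; case: ifP => aS; last first.
  by rewrite (_ : [set _ | _] = set0) ?cards0 //; apply/setP => b; rewrite !inE.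
exact: h.
Qed.

Lemma card_pairs_ge (A B : finType) (S : {set A}) (P : A -> B -> bool) c k :
  (forall a, a \in S -> k <= c * #|[set b | P a b]|) ->
  #|S| * k <= c * #|[set p : A * B | (p.1 \in S) && P p.1 p.2]|.
Proof.
move=> h; rewrite (card_pairs (fun a b => (a \in S) && P a b)) -sum_nat_const.
rewrite big_distrr /= [leqLHS]big_mkcond; apply: leq_sum => a _; case: ifP => aS //.
exact: h.
Qed.

Definition few_buds (J : nat) := [set m in LT | #|buds m| <= J].

Definition zippable (k : nat) m d :=
  (start m d != start m (next m d)) && (#|start m d| <= k).

(** A pair [(m, d)] is encoded injectively by the zipped map, its new bud and the number of rotation
    steps after which the partner of this bud is met. Zipping adds at most four buds, so there are
    at most [J + 4] choices of the bud. *)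
Lemma zippable_count J k :
  #|[set p : labelled_map D * D | (p.1 \in few_buds J) && zippable k p.1 p.2]|
  <= #|few_buds (J + 4)| * (J + 4) * k.+1.
Proof.
pose arc (m : labelled_map D) d := find (fun j => iter j (turn (zipped m d)) d ==
  glue m (next m (next m d))) (iota 0 k).
pose F (p : labelled_map D * D) : labelled_map D * D * 'I_k.+1 :=
  (zipped p.1 p.2, next p.1 (next p.1 p.2), inord (arc p.1 p.2)).
set U := [set p | _].
have arcP m d : (m, d) \in U -> arc m d < k /\
    iter (arc m d) (turn (zipped m d)) d = glue m (next m (next m d)).
  rewrite !inE /= => /andP[/andP[mt _] /andP[nl dk]].
  have mLT : m \in LT by rewrite inE.
  have [gK gN n3 nN cn] := labelled_triangulationP mLT.
  have [j jd ej] := zipped_turn gK gN n3 nN nl.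
  have h : has (fun j => iter j (turn (zipped m d)) d == glue m (next m (next m d))) (iota 0 k).
    by apply/hasP; exists j; rewrite ?ej // mem_iota add0n; apply: leq_trans jd dk.
  have ak : arc m d < k by rewrite -[X in _ < X](size_iota 0) -has_find.
  by split=> //; have := nth_find 0 h; rewrite -/(arc m d) nth_iota // => /eqP.
have ULT m d : (m, d) \in U -> m \in LT /\ start m d != start m (next m d).
  by rewrite !inE /= => /andP[/andP[mt _] /andP[nl dk]].
have Finj : {in U &, injective F}.
  move=> [m d] [m' d'] /= mdU mdU' eF.
  have [ak aE] := arcP _ _ mdU; have [ak' aE'] := arcP _ _ mdU'.
  have [mLT nl] := ULT _ _ mdU; have [mLT' nl'] := ULT _ _ mdU'.
  have [gK gN n3 nN cn] := labelled_triangulationP mLT; have [gK' gN' n3' nN' cn'] := labelled_triangulationP mLT'.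
  have ez : zipped m d = zipped m' d' := congr1 (fun p => p.1.1) eF.
  have en : next m = next m' := congr1 (fun m => next m) ez.
  have er : root m = root m' := congr1 (fun m => root m) ez.
  have eb : next m (next m d) = next m' (next m' d') := congr1 (fun p => p.1.2) eF.
  have ed : d = d' by rewrite -(n3 d) eb en n3'.
  have ea : arc m d = arc m' d'.
    have := congr1 (fun p => val p.2) eF.
    by rewrite /= !inordK // ltnS ltnW.
  have eg : glue m = glue m'.
    rewrite (zipped_recover gK gN nN aE) (zipped_recover gK' gN' nN' aE').
    by rewrite ez ea ed en.
  by rewrite ed (labelled_map_eq eg en er).
rewrite -(card_in_imset Finj).
pose V := [set p : labelled_map D * D | (p.1 \in few_buds (J + 4)) && (p.2 \in buds p.1)].
have FV : F @: U \subset setX V [set: 'I_k.+1].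
  apply/subsetP => _ /imsetP[[m d] mdU ->]; rewrite !inE /= andbT.
  have [mLT nl] := ULT _ _ mdU; have [gK gN n3 nN cn] := labelled_triangulationP mLT.
  have := zipped_bud d gK gN nN; rewrite inE => ->; rewrite andbT.
  have mJ : #|buds m| <= J by move: mdU; rewrite !inE /= => /andP[/andP[]].
  rewrite (leq_trans (zipped_card_buds d gK)) ?leq_add2r // andbT.
  have := labelled_triangulation_glue (m' := zipped m d) mLT (erefl _).
  rewrite inE; apply; first exact: card_edges_rewire.
  - exact: zipped_vertices.
  - exact: zipped_invol.
  - exact: rewire_fpf.
  - exact: zipped_connected.
apply: leq_trans (subset_leq_card FV) _; rewrite cardsX cardsT card_ord leq_mul2r /=.
apply: (card_pairs_le (P := fun m b => b \in buds m)) => m; rewrite inE => /andP[_]; apply: leq_trans.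
by apply: subset_leq_card; apply/subsetP => b; rewrite inE.
Qed.

End LabelledTriangulations.

Lemma sum_card_porbits (D : finType) (s : {perm D}) :
  \sum_(v in porbits s) #|v| = #|D|.
Proof.
rewrite -[RHS]sum1_card (partition_big_imset (porbit s)) /=.
apply: eq_bigr => _ /imsetP[x _ ->]; rewrite -sum1_card.
by apply: eq_bigl => y; rewrite -eq_porbit_mem.
Qed.

(** If all sides at a vertex were loops, they would be closed under gluing, and connectivity would
    leave a single vertex. The end of [d] appears as [start m (next m d)]. *)
Lemma nonloop_exists (D : finType) (m : labelled_map D) x : involutive (glue m) -> connected m -> 1 < #|vertices m| ->
  exists2 d, start m d = start m x & start m d != start m (next m d).
Proof.
move=> gK cn v1.
have [/existsP[d /andP[/eqP e nl]]|] :=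
  boolP [exists d, (start m d == start m x) && (start m d != start m (next m d))].
  by exists d.
rewrite negb_exists => /forallP loops.
have gP z : start m z == start m x -> start m (glue m z) == start m x.
  move=> /eqP e; have := loops z; rewrite e eqxx /= negbK => /eqP ->.
  by rewrite -start_turn turnE gK.
have all_x z : start m z == start m x.
  have [k r] := cn x z.
  apply: (proj1 (reach_map (m' := m) (P := fun z => start m z == start m x)
    (f := fun=> x) gP _ _ _ (eqxx _) r)) => //.
  - by move=> u; rewrite start_turn.
  - by move=> u _; apply: reach_refl.
suff : vertices m = [set start m x] by move=> e; rewrite e cards1 in v1.
apply/setP => v; rewrite inE; apply/imsetP/eqP => [[y _ ->]|->]; last by exists x.
by apply/eqP/all_x.
Qed.

Section LabelledTriangulations.
Variables n g : nat.
Notation D := (sides n).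
Notation LT := (labelled_triangulations n g).
Implicit Type m : labelled_map D.

(** The degrees add up to [#|D|], and each vertex of degree above [k] uses at least [k.+1] of them.
    Every other vertex is the start of a zippable side. *)
Lemma zippable_many k m : m \in LT -> 1 < #|vertices m| ->
  #|vertices m| * k.+1 <= #|[set d | zippable k m d]| * k.+1 + #|D|.
Proof.
move=> mLT v1; have [gK gN n3 nN cn] := labelled_triangulationP mLT.
rewrite -[X in _ + X](sum_card_porbits (turn m)) -/(vertices m).
rewrite (bigID (fun v : {set D} => #|v| <= k)) /= addnCA.
pose low := [set v in vertices m | #|v| <= k].
pose high := [set v in vertices m | ~~ (#|v| <= k)].
have -> : #|vertices m| = #|low| + #|high|.
  rewrite -(cardsID [set v : {set D} | #|v| <= k] (vertices m)).
  by congr (_ + _); apply: eq_card => v; rewrite !inE // andbC.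
rewrite mulnDl.
have lo : #|low| <= #|[set d | zippable k m d]|.
  apply: leq_trans (leq_imset_card (start m) _); apply: subset_leq_card.
  apply/subsetP => v; rewrite inE => /andP[/imsetP[x _ ->] lx].
  have [d e nl] := nonloop_exists x gK cn v1.
  by apply/imsetP; exists d; rewrite ?e // inE /zippable nl [start m d]e.
have hi : #|high| * k.+1 <= \sum_(v in vertices m | ~~ (#|v| <= k)) #|v|.
  rewrite -sum_nat_const [leqLHS](eq_bigl (fun v => (v \in vertices m) && ~~ (#|v| <= k))).
    by apply: leq_sum => v /andP[_]; rewrite -ltnNge.
  by move=> v; rewrite inE.
apply: leq_trans (leq_add (leq_mul lo (leqnn _)) hi) _.
exact: leq_addl.
Qed.

Variable K : nat.
Hypothesis n_gt0 : 0 < n.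
Hypothesis many_vertices : forall m, m \in LT -> n <= K * #|vertices m| /\ 1 < #|vertices m|.

(** Double counting of the zippings: each triangulation with few buds admits at least n / (2K) of
    them, and each result with its extra buds arises from at most 12K(J + 4). *)
Lemma few_buds_double J : 48 * K ^ 2 * (J + 4) <= n ->
  2 * #|few_buds n g J| <= #|few_buds n g (J + 4)|.
Proof.
move=> Jn.
have [-> | F0] := posnP #|few_buds n g J|; first by rewrite muln0.
have K0 : 0 < K.
  move: F0; rewrite card_gt0 => /set0Pn[m]; rewrite inE => /andP[/many_vertices[h _] _].
  by move: n_gt0; apply: contraTltn; case: (K) h => //; rewrite mul0n leqn0 => /eqP->.
(* The average degree is at most 6K, so at least half of the vertices have degree below 12K. *)
pose k := (12 * K).-1; have kE : k.+1 = 12 * K by rewrite /k prednK // muln_gt0.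
have zm m : m \in few_buds n g J -> n <= 2 * K * #|[set d | zippable k m d]|.
  rewrite inE => /andP[mLT _]; have [nV v1] := many_vertices mLT.
  have := zippable_many k mLT v1; rewrite kE card_ord.
  set V := #|vertices m| in nV v1 *; set z := #|_| => h.
  have h1 : V * (12 * K) <= z * (12 * K) + 6 * (K * V) by nia.
  have h2 : V * K <= (2 * z) * K by nia.
  have h3 : V <= 2 * z by rewrite -(leq_pmul2r K0).
  by apply: leq_trans nV _; rewrite mulnAC [_ * K]mulnC leq_mul2l h3 orbT.
have lo := leq_trans (card_pairs_ge zm) (leq_mul (leqnn _) (zippable_count n g J k)).
rewrite kE in lo.
set F := #|few_buds n g J| in lo F0 *; set F' := #|_| in lo *.
have h : F * n <= F' * (24 * K ^ 2 * (J + 4)) by apply: leq_trans lo _; rewrite leq_eqVlt; apply/orP; left; apply/eqP; nia.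
have h' : F' * (48 * K ^ 2 * (J + 4)) <= F' * n by rewrite leq_mul2l Jn orbT.
rewrite -(leq_pmul2r n_gt0); apply: leq_trans h'.
rewrite -mulnA; apply: leq_trans (leq_mul (leqnn 2) h) _.
by rewrite leq_eqVlt; apply/orP; left; apply/eqP; nia.
Qed.

(** The bound on the number of buds is raised from 4i to 8i in [i] steps of four, and the count at
    least doubles each time. *)
Lemma few_buds_rare i : 48 * K ^ 2 * (8 * i) <= n ->
  2 ^ i * #|few_buds n g (4 * i)| <= #|LT|.
Proof.
move=> h; suff H j : j <= i ->
    2 ^ j * #|few_buds n g (4 * i)| <= #|few_buds n g (4 * i + 4 * j)|.
  apply: leq_trans (H i (leqnn _)) _; apply: subset_leq_card.
  by apply/subsetP => m; rewrite inE => /andP[].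
elim: j => [|j IH] ji; first by rewrite mul1n muln0 addn0.
rewrite expnS -mulnA; apply: leq_trans (leq_mul (leqnn 2) (IH (ltnW ji))) _.
rewrite mulnS (addnC 4) addnA; apply: few_buds_double.
by apply: leq_trans h; rewrite leq_mul2l; apply/orP; right; lia.
Qed.

End LabelledTriangulations.

(** * Growing a tentacle *)

(** Each of the six positions in the gadget is an invertible word in [glue] and [next] applied to
    [b], so [e] at a given position determines [b]; [n2] inverts [next]. *)
Lemma gadgets_through (D : finType) (m : labelled_map D) (e : D) :
  involutive (glue m) -> (forall z, next m (next m (next m z)) = z) ->
  #|[set b | e \in gadget m b]| <= 6.
Proof.
move=> gK n3; pose n2 z := next m (next m z).
have n2P x y : x = next m y -> n2 x = y by move=> ->; rewrite /n2 n3.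
have gP x y : x = glue m y -> glue m x = y by move=> ->; rewrite gK.
pose s := [:: e; n2 e; n2 (n2 e); n2 (glue m e); n2 (glue m (n2 e));
  n2 (glue m (n2 (n2 e)))].
apply: leq_trans (card_size s); apply: subset_leq_card; apply/subsetP => b.
rewrite /s !inE => /or4P[/eqP<-|/eqP/n2P<-|/eqP/n2P/n2P<-|];
  rewrite ?eqxx ?orbT // => /or3P[/eqP/gP/n2P<-|/eqP/n2P/gP/n2P<-|/eqP/n2P/n2P/gP/n2P<-];
  by rewrite eqxx ?orbT.
Qed.

Section LabelledTriangulations.
Variables n g : nat.
Notation D := (sides n).
Notation LT := (labelled_triangulations n g).
Implicit Type m : labelled_map D.
Hypothesis n_gt1 : 1 < n.

Let D6 : 6 < #|D|. Proof. by rewrite card_ord; lia. Qed.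

Definition tentacles (h B : nat) := [set s : labelled_map D * D * D |
  [&& s.1.1 \in LT, B <= #|buds s.1.1| &
      boolp.asbool (tip_dominates h s.1.1 s.1.2 s.2)]].

Definition movable (s : labelled_map D * D * D) (b : D) :=
  [&& b \in buds s.1.1, s.1.2 \notin gadget s.1.1 b & s.2 \notin gadget s.1.1 b].

Lemma movable_many h B s : s \in tentacles h (B + 12) -> B <= #|[set b | movable s b]|.
Proof.
case: s => [[m e] y]; rewrite inE /= => /and3P[mLT Bm _].
have [gK gN n3 nN cn] := labelled_triangulationP mLT.
pose We := [set b | e \in gadget m b]; pose Wy := [set b | y \in gadget m b].
have sub : buds m \subset [set b | movable (m, e, y) b] :|: (We :|: Wy).
  apply/subsetP => b bb; rewrite !in_setU ![in X in X || _]inE /movable /= bb.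
  by rewrite !in_set -negb_or orNb.
rewrite -(leq_add2r 12); apply: leq_trans (leq_trans Bm (subset_leq_card sub)) _.
apply: leq_trans (leq_card_setU _ _) _; rewrite leq_add2l.
apply: leq_trans (leq_card_setU _ _) _.
exact: (leq_add (gadgets_through e gK n3) (gadgets_through y gK n3)).
Qed.

(** At least [B] buds can be moved to the tip, since at most twelve have [e] or [y] in their gadget.
    The move is injective once the place the bud came from is recorded, which has [#|D|] values; two
    rewirings destroy at most eight buds. *)
Lemma tentacles_step h B :
  #|tentacles h.+1 (B + 12)| * B <= #|tentacles h (B + 4)| * #|D|.
Proof.
have lo := card_pairs_ge (c := 1) (S := tentacles h.+1 (B + 12)) (P := movable) (k := B).
have {}lo := lo (fun s sS => eq_ind_r (leq B) (movable_many sS) (mul1n _)).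
rewrite mul1n in lo; apply: leq_trans lo _; set U := [set p | _].
pose F (p : labelled_map D * D * D * D) : labelled_map D * D * D * D :=
  (transplant p.1.1.1 p.2 p.1.1.2, p.2, p.1.2, glue p.1.1.1 (base_side p.1.1.1 p.2)).
have UP m e y b : (m, e, y, b) \in U ->
    [/\ m \in LT, B + 12 <= #|buds m|, tip_dominates h.+1 m e y,
        b \in buds m & e \notin gadget m b /\ y \notin gadget m b].
  rewrite inE /movable /= => /andP[]; rewrite inE /=.
  by move=> /and3P[? ? /boolp.asboolP ?] /and3P[].
have Finj : {in U &, injective F}.
  move=> [[[m e] y] b] [[[m' e'] y'] b'] /UP[mLT Bm dom bb [eG yG]].
  move=> /UP[mLT' Bm' dom' bb' [eG' yG']] eF.
  have [gK gN n3 nN cn] := labelled_triangulationP mLT; have [gK' gN' n3' nN' cn'] := labelled_triangulationP mLT'.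
  have ez : transplant m b e = transplant m' b' e' := congr1 (fun p => p.1.1.1) eF.
  have eb : b = b' := congr1 (fun p => p.1.1.2) eF.
  have ey : y = y' := congr1 (fun p => p.1.2) eF.
  have ep : glue m (base_side m b) = glue m' (base_side m' b') := congr1 (fun p => p.2) eF.
  have en : next m = next m' := congr1 (fun m => next m) ez.
  have er : root m = root m' := congr1 (fun m => root m) ez.
  have bs := transplant_base_side gK gN n3 nN cn D6 bb eG.
  have bs' := transplant_base_side gK' gN' n3' nN' cn' D6 bb' eG'.
  have e1 : base_side m b = base_side m' b'.
    by rewrite [LHS](esym bs) [RHS](esym bs') ez eb.
  have ee : e = e'.
    rewrite -(transplant_end gK gN n3 nN cn D6 bb eG) -(transplant_end gK' gN' n3' nN' cn' D6 bb' eG').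
    by rewrite -/(base_side m b) -/(base_side m' b') ez e1 en.
  have eg : glue m = glue m'.
    rewrite (transplant_recover e gK gN n3 nN bb) (transplant_recover e' gK' gN' n3' nN' bb').
    by rewrite -!/(base_side _ _) ez e1 ee -e1 ep e1 en.
  by rewrite ee ey eb (labelled_map_eq eg en er).
rewrite -(card_in_imset Finj).
have FV : F @: U \subset setX (tentacles h (B + 4)) [set: D].
  apply/subsetP => _ /imsetP[[[[m e] y] b] /UP[mLT Bm dom bb [eG yG]] ->].
  have [gK gN n3 nN cn] := labelled_triangulationP mLT.
  rewrite in_setX inE in_setT andbT /=; apply/and3P; split.
  - apply: (labelled_triangulation_glue mLT) => //.
    + by rewrite /transplant !card_edges_rewire.
    + exact: transplant_vertices.
    + by do 2 apply: rewire_invol.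
    + by do 2 apply: rewire_fpf.
    + exact: transplant_connected.
  - by rewrite -(leq_add2r 8) -addnA; apply: leq_trans Bm (transplant_card_buds b e gK).
  - by apply/boolp.asboolP; apply: (transplant_tip_dominates gK gN n3 nN cn D6 bb eG yG dom).
by apply: leq_trans (subset_leq_card FV) _; rewrite cardsX cardsT.
Qed.

Lemma tentacles_grow h B :
  #|tentacles h (B + 8 * h + 12)| * B ^ h <= #|tentacles 0 (B + 12)| * #|D| ^ h.
Proof.
elim: h => [|h IH]; first by rewrite muln0 addn0.
rewrite !expnSr !mulnA.
have e1 : B + 8 * h.+1 + 12 = (B + 8 * h + 8) + 12 by lia.
have st := tentacles_step h (B + 8 * h + 8); rewrite -e1 -(addnA _ 8 4) in st.
have le : #|tentacles h.+1 (B + 8 * h.+1 + 12)| * B <= #|tentacles h (B + 8 * h + 12)| * #|D|.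
  by apply: leq_trans st; rewrite leq_mul2l; apply/orP; right; lia.
rewrite mulnAC; apply: leq_trans (leq_mul le (leqnn _)) _.
by rewrite mulnAC leq_mul2r IH orbT.
Qed.

(** The invariant with h = 0, applied to a chosen diametral pair, contradicts its maximality unless
    the tip is one of its two members. A boolean records which one. *)
Lemma tentacles0 B : #|tentacles 0 B| <= #|LT| * (2 * #|D|).
Proof.
pose pr m : D * D := [arg max_(p > (root m, root m)) vdist m p.1 p.2].
have prP m u v : vdist m u v <= vdist m (pr m).1 (pr m).2.
  by rewrite /pr; case: arg_maxnP => // p _ /(_ (u, v)); apply.
pose F (s : labelled_map D * D * D) : labelled_map D * (bool * D) :=
  (s.1.1, (s.1.2 == (pr s.1.1).1, s.2)).
have SP m e y : (m, e, y) \in tentacles 0 B ->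
    m \in LT /\ (e = (pr m).1 \/ e = (pr m).2).
  rewrite inE /= => /and3P[mLT _ /boolp.asboolP dom]; split=> //.
  have [|n1] := eqVneq e (pr m).1; first by left.
  have [|n2] := eqVneq e (pr m).2; first by right.
  by have [] := dom (pr m).1 (pr m).2; rewrite 1?eq_sym // ?addn0 ltnNge prP.
have Finj : {in tentacles 0 B &, injective F}.
  move=> [[m e] y] [[m' e'] y'] /SP[_ h] /SP[_ h'] eF.
  have em : m = m' := congr1 (fun p => p.1) eF.
  have eb : (e == (pr m).1) = (e' == (pr m').1) := congr1 (fun p => p.2.1) eF.
  have ey : y = y' := congr1 (fun p => p.2.2) eF.
  rewrite -em in h' eb *; rewrite ey; congr (_, _, _).
  by case: eqP eb h => [-> /esym/eqP-> //|n1 /esym/eqP n2 [//|->]]; case: h'.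
rewrite -(card_in_imset Finj).
have FV : F @: tentacles 0 B \subset setX LT [set: bool * D].
  apply/subsetP => _ /imsetP[[[m e] y] /SP[mLT _] ->].
  by rewrite in_setX in_setT andbT.
apply: leq_trans (subset_leq_card FV) _.
by rewrite cardsX cardsT card_prod card_bool.
Qed.

(** A nearly diametral pair satisfies the invariant with tip [x], always by its first alternative,
    so the growth can start there. *)
Lemma bad_tentacles h B (S : {set labelled_map D * D * D}) :
  (forall m x y, (m, x, y) \in S ->
    [/\ m \in LT, B + 8 * h + 12 <= #|buds m| & diam m < vdist m x y + h]) ->
  #|S| * B ^ h <= #|LT| * (2 * #|D|) * #|D| ^ h.
Proof.
move=> SP; apply: leq_trans (_ : #|tentacles h (B + 8 * h + 12)| * B ^ h <= _).
  rewrite leq_mul2r; apply/orP; right; apply: subset_leq_card.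
  apply/subsetP => -[[m x] y] /SP[mLT mB mD]; rewrite inE /= mLT mB /=.
  apply/boolp.asboolP => u v _ _; constructor 1.
  by apply: leq_ltn_trans mD; apply: vdist_diam.
apply: leq_trans (tentacles_grow h B) _.
by rewrite leq_mul2r tentacles0 orbT.
Qed.

End LabelledTriangulations.

(** * Existence of triangulations *)

Section SumMap.
Variables A B : finType.

Definition sum_fun (s : {perm A}) (t : {perm B}) (z : A + B) : A + B :=
  match z with inl x => inl (s x) | inr y => inr (t y) end.

Lemma sum_fun_inj s t : injective (sum_fun s t).
Proof. by move=> [x|x] [y|y] //= [/perm_inj->]. Qed.

Definition sum_perm s t : {perm A + B} := perm (@sum_fun_inj s t).

(* Disjoint union, hence not connected; only one of the two roots is kept. *)
Definition sum_map (m : labelled_map A) (m' : labelled_map B) :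
    labelled_map (A + B)%type :=
  (sum_perm (glue m) (glue m'), sum_perm (next m) (next m'), inl (root m)).

Variables (m : labelled_map A) (m' : labelled_map B).
Let M := sum_map m m'.

Lemma sum_permE s t z : sum_perm s t z = sum_fun s t z.
Proof. exact: permE. Qed.

Lemma glue_sum z : glue M z = sum_fun (glue m) (glue m') z.
Proof. exact: sum_permE. Qed.

Lemma next_sum z : next M z = sum_fun (next m) (next m') z.
Proof. exact: sum_permE. Qed.

Lemma turn_sum z : turn M z = sum_fun (turn m) (turn m') z.
Proof. by rewrite turnE glue_sum next_sum; case: z => x /=; rewrite turnE. Qed.

Lemma card_vertices_sum : #|vertices M| = #|vertices m| + #|vertices m'|.
Proof.
pose L := [set porbit (turn M) (inl x) | x in A].
pose R := [set porbit (turn M) (inr x) | x in B].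
have inlI : injective (@inl A B) by move=> x y [].
have inrI : injective (@inr A B) by move=> x y [].
have cL : #|L| = #|vertices m| by apply: card_porbits_inj => // x; rewrite turn_sum.
have cR : #|R| = #|vertices m'| by apply: card_porbits_inj => // x; rewrite turn_sum.
rewrite -cL -cR -cardsUI.
have -> : L :&: R = set0.
  apply/setP => v; rewrite !inE; apply/negP => /andP[/imsetP[x _ ->] /imsetP[y _]].
  move/eqP; rewrite eq_porbit_mem => /(porbit_closed (P := fun z => if z is inr _ then true else false)) h.
  suff : if (inl x : A + B) is inr _ then true else false by [].
  by apply: h => // -[u|u]; rewrite // turn_sum.
rewrite cards0 addn0; apply: eq_card => v; rewrite inE.
apply/imsetP/orP => [[[x|x] _ ->]|[]/imsetP[x _ ->]].
- by left; apply: imset_f.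
- by right; apply: imset_f.
- by exists (inl x).
- by exists (inr x).
Qed.

End SumMap.

(* Two triangles; [option bool] stands for the three sides of a triangle. *)
Definition side6 := (bool * option bool)%type.

Definition rot6 (z : side6) : side6 :=
  (z.1, match z.2 with None => Some false | Some false => Some true | Some true => None end).

(** The closed gadget: each triangle has two sides glued together, and the third sides are glued to
    each other. *)
Definition sphere_glue6 (z : side6) : side6 :=
  match z.2 with None => (~~ z.1, None) | Some c => (z.1, Some (~~ c)) end.

(** Gluing corresponding sides of the two triangles gives the torus with one vertex. *)
Definition torus_glue6 (z : side6) : side6 := (~~ z.1, z.2).

Lemma rot6_inj : injective rot6.
Proof. by move=> [[] [[]|]] [[] [[]|]]. Qed.
Lemma sphere_glue6K : involutive sphere_glue6.
Proof. by move=> [[] [[]|]]. Qed.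
Lemma torus_glue6K : involutive torus_glue6.
Proof. by move=> [[] [[]|]]. Qed.

Definition sphere6 : labelled_map side6 :=
  (perm (can_inj sphere_glue6K), perm rot6_inj, (false, None)).
Definition torus6 : labelled_map side6 :=
  (perm (can_inj torus_glue6K), perm rot6_inj, (false, None)).

Lemma glue_sphere6 z : glue sphere6 z = sphere_glue6 z. Proof. exact: permE. Qed.
Lemma next_sphere6 z : next sphere6 z = rot6 z. Proof. exact: permE. Qed.
Lemma glue_torus6 z : glue torus6 z = torus_glue6 z. Proof. exact: permE. Qed.
Lemma next_torus6 z : next torus6 z = rot6 z. Proof. exact: permE. Qed.

Lemma card_side6 : #|{: side6}| = 6.
Proof. by rewrite card_prod card_option card_bool. Qed.

Lemma vertices_sphere6 : #|vertices sphere6| = 3.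
Proof.
have tE z : turn sphere6 z = rot6 (sphere_glue6 z).
  by rewrite turnE next_sphere6 glue_sphere6.
have fx c : porbit (turn sphere6) (c, Some true) = [set (c, Some true)].
  apply/setP => z; rewrite inE; apply/idP/eqP => [h|->]; last exact: porbit_id.
  apply/eqP; apply: (porbit_closed (P := pred1 (c, Some true)) _ _ h) => /=.
    by move=> u /eqP->; rewrite tE; case: (c).
  exact: eqxx.
have st z : porbit (turn sphere6) (rot6 (sphere_glue6 z)) = porbit (turn sphere6) z.
  by rewrite -tE porbit_step.
pose o := porbit (turn sphere6) (false, None).
have -> : vertices sphere6 = [set o; [set (false, Some true)]; [set (true, Some true)]].
  apply/setP => v; rewrite !inE -!orbA; apply/imsetP/idP.
    move=> [[c d] _ ->]; case: d => [[]|].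
    - by rewrite fx; case: (c); rewrite eqxx ?orbT.
    - have -> : porbit (turn sphere6) (c, Some false) = o; last by rewrite eqxx.
      rewrite -(st (c, Some false)); case: c => //.
      by rewrite -(st (true, None)) -(st _).
    - have -> : porbit (turn sphere6) (c, None) = o; last by rewrite eqxx.
      case: c => //; by rewrite -(st (true, None)) -(st _).
  by move=> /or3P[] /eqP ->; [exists (false, None) | exists (false, Some true) | exists (true, Some true)]; rewrite ?fx.
have no c : o != [set (c, Some true)].
  apply/eqP => e; have := porbit_id (turn sphere6) (false, None).
  by rewrite -/o e inE; case: (c).
rewrite -setUA cardsU1 cards2 !inE !negb_or !no /=.
by case: eqP => // /setP/(_ (false, Some true)); rewrite !inE.
Qed.

Lemma vertices_torus6 : #|vertices torus6| = 1.
Proof.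
have st z : porbit (turn torus6) (rot6 (torus_glue6 z)) = porbit (turn torus6) z.
  by rewrite -(porbit_step (turn torus6) z) turnE next_torus6 glue_torus6.
suff -> : vertices torus6 = [set porbit (turn torus6) (false, None)] by rewrite cards1.
apply/setP => v; rewrite inE; apply/imsetP/eqP => [[z _ ->]|->]; last by exists (false, None).
have s1 := st (false, None); have s2 := st (true, Some false).
have s3 := st (false, Some true); have s4 := st (true, None).
have s5 := st (false, Some false).
rewrite /rot6 /torus_glue6 /= in s1 s2 s3 s4 s5.
by case: z => [[] [[]|]] //; rewrite ?s5 ?s4 ?s3 ?s2 ?s1.
Qed.

Definition is_trimap (D : finType) (m : labelled_map D) :=
  [/\ involutive (glue m), (forall z, glue m z != z),
      (forall z, next m (next m (next m z)) = z), (forall z, next m z != z) &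
      connected m].

Lemma sphere6_connected : connected sphere6.
Proof.
have gK : involutive (glue sphere6).
  by move=> z; rewrite !glue_sphere6 sphere_glue6K.
have lg z : linked sphere6 z (sphere_glue6 z) by rewrite -glue_sphere6; apply: linked_glue.
have ln z : linked sphere6 z (rot6 z) by rewrite -next_sphere6; apply: linked_next.
have ll c d : linked sphere6 (c, d) (c, None).
  case: d => [[]|]; first exact: (ln (c, Some true)).
    by apply: linked_trans (ln (c, Some false)) (ln (c, Some true)).
  exact: linked_refl.
have l0 z : linked sphere6 z (false, None).
  case: z => [[] d]; last exact: ll.
  by apply: linked_trans (ll _ _) (lg (true, None)).
move=> x y; apply: linked_trans (l0 x) (linked_sym gK (l0 y)).
Qed.

Lemma sphere6_trimap : is_trimap sphere6.
Proof.
split; last exact: sphere6_connected.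
- by move=> z; rewrite !glue_sphere6 sphere_glue6K.
- by move=> z; rewrite glue_sphere6; case: z => [[] [[]|]].
- by move=> z; rewrite !next_sphere6; case: z => [[] [[]|]].
- by move=> z; rewrite next_sphere6; case: z => [[] [[]|]].
Qed.

(** The type of sides is left free because gluing pieces together produces sum types; sides are
    numbered only at the end. *)
Definition trimap_exists n v := exists (D : finType) (m : labelled_map D),
  [/\ #|D| = 6 * n, is_trimap m & #|vertices m| = v].

Lemma trimap_sphere : trimap_exists 1 3.
Proof.
exists side6, sphere6; split; rewrite ?vertices_sphere6 ?card_side6 //.
exact: sphere6_trimap.
Qed.

Section Sums.
Variables (D : finType) (m : labelled_map D) (m6 : labelled_map side6).
Hypothesis tm : is_trimap m.
Hypothesis g6 : involutive (glue m6).
Hypothesis gN6 : forall z, glue m6 z != z.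
Hypothesis n6 : forall z, next m6 z = rot6 z.
Let M := sum_map m m6.

Lemma sum_invol : involutive (glue M).
Proof.
by case: tm => gK _ _ _ _ [x|x]; rewrite !glue_sum /= ?gK ?g6.
Qed.

Lemma sum_fpf z : glue M z != z.
Proof.
case: tm => _ gN _ _ _; case: z => x; rewrite glue_sum /=.
  by apply/eqP => -[/eqP]; rewrite (negPf (gN x)).
by apply/eqP => -[/eqP]; rewrite (negPf (gN6 x)).
Qed.

Lemma sum_next3 z : next M (next M (next M z)) = z.
Proof.
case: tm => _ _ n3 _ _; case: z => x; rewrite !next_sum /= ?n3 //.
by rewrite !n6; case: x => [[] [[]|]].
Qed.

Lemma sum_nextN z : next M z != z.
Proof.
case: tm => _ _ _ nN _; case: z => x; rewrite !next_sum /=.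
  by apply/eqP => -[/eqP]; rewrite (negPf (nN x)).
by rewrite n6; case: x => [[] [[]|]].
Qed.

End Sums.

(** A closed gadget is inserted into the root edge: two more faces, and three more vertices of which
    two get identified with old ones. *)
Lemma trimap_add_vertex n v : trimap_exists n v -> trimap_exists n.+1 v.+1.
Proof.
move=> [D [m [cD tm vm]]].
have [gK6 gN6 _ _ _] := sphere6_trimap.
pose M := sum_map m sphere6.
have gK := sum_invol tm gK6; have gN := sum_fpf tm gN6.
have n3 := sum_next3 tm next_sphere6; have nN := sum_nextN tm next_sphere6.
rewrite -/M in gK gN n3 nN.
pose b : D + side6 := inr (false, Some true); pose e : D + side6 := inl (root m).
have MN u : next M (inr u) = inr (rot6 u) by rewrite next_sum /= next_sphere6.
have MG u : glue M (inr u) = inr (sphere_glue6 u) by rewrite glue_sum /= glue_sphere6.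
have gb : glue M b = next M (next M b) by rewrite !(MN, MG).
have gE : gadget M b = [:: inr (false, Some true); inr (false, None); inr (false, Some false);
   inr (true, None); inr (true, Some false); inr (true, Some true)].
  by rewrite /gadget !(MN, MG).
have gb1 : glue M (next M (glue M (next M b))) = next M (next M (glue M (next M b))).
  by rewrite !(MN, MG).
have eG : e \notin gadget M b by rewrite gE.
exists (D + side6)%type, (rewire M (next M (next M (glue M (next M b)))) e); split.
- by rewrite card_sum cD card_side6 mulnS addnC.
- split=> //; [exact: rewire_invol | exact: rewire_fpf |].
  apply: (proj1 (insert_connected gK gN n3 nN gb gb1 eG)) => x y.
  have inG z : inr z \in gadget M b by rewrite gE; case: z => [[] [[]|]].
  case: x => [x _|x]; last by rewrite inG.
  case: y => [y _|y]; last by rewrite inG.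
  have [_ _ _ _ cn] := tm.
  apply: (linked_map (m := M) (f := inl)) (cn x y) => z.
    have -> : inl (glue m z) = glue M (inl z) by rewrite glue_sum.
    exact: linked_glue.
  have -> : inl (next m z) = next M (inl z) by rewrite next_sum.
  exact: linked_next.
- apply: (@addIn 2); rewrite insert_vertices //.
  by rewrite card_vertices_sum vertices_sphere6 vm addn3 addn2.
Qed.

(** A connected sum with the torus along an edge with distinct endpoints, both of which merge with
    the single vertex of the torus. Two faces more and one vertex less raise the genus by one. *)
Lemma trimap_add_handle n v : trimap_exists n v.+2 -> trimap_exists n.+1 v.+1.
Proof.
move=> [D [m [cD tm vm]]].
have gK6 : involutive (glue torus6) by move=> z; rewrite !glue_torus6 torus_glue6K.
have gN6 z : glue torus6 z != z by rewrite glue_torus6; case: z => [[] [[]|]].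
pose M := sum_map m torus6.
have gK := sum_invol tm gK6; have gN := sum_fpf tm gN6.
have n3 := sum_next3 tm next_torus6; have nN := sum_nextN tm next_torus6.
rewrite -/M in gK gN n3 nN.
have [gKm gNm n3m nNm cn] := tm.
have [e _ nl] : exists2 e, start m e = start m (root m) & start m e != start m (next m e).
  by apply: nonloop_exists; rewrite // vm.
have {}nl : start m e != start m (glue m e).
  by rewrite -(start_turn m (glue m e)) turnE gKm.
pose x : D + side6 := inr (false, None); pose y : D + side6 := inl e.
have xy : x != y by [].
have gx : glue M x = inr (true, None) by rewrite glue_sum /= glue_torus6.
have gy : glue M y = inl (glue m e) by rewrite glue_sum.
pose M2 := rewire M x y.
have gK2 : involutive (glue M2) by apply: rewire_invol.
have ln z : linked M2 z (next M z) by apply: (@linked_next _ M2).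
have lnr c d : linked M2 (inr (c, d)) (inr (c, None)).
  have ln' u : linked M2 (inr u) (inr (rot6 u)).
    by have := ln (inr u); rewrite next_sum /= next_torus6.
  case: d => [[]|]; first exact: (ln' (c, Some true)).
    by apply: linked_trans (ln' (c, Some false)) (ln' (c, Some true)).
  exact: linked_refl.
have lx : linked M2 (inr (true, None)) x.
  apply: linked_trans (linked_sym gK2 (lnr _ (Some true))) _.
  apply: linked_trans (lnr _ (Some true)).
  have -> : inr (false, Some true) = glue M2 (inr (true, Some true)).
    rewrite glue_rewireD ?gx ?gy //.
    by rewrite glue_sum /= glue_torus6.
  exact: linked_glue.
have lr u : linked M2 (inr u) x.
  case: u => [[] d]; last exact: lnr.
  exact: linked_trans (lnr _ _) lx.
have lyx : linked M2 y x.
  have <- : glue M2 y = x by apply: glue_rewire2.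
  exact: linked_glue.
have lgyx : linked M2 (inl (glue m e)) x.
  apply: linked_trans lx.
  have <- : glue M2 (inl (glue m e)) = inr (true, None).
    by rewrite -gy -gx; apply: glue_rewire4.
  exact: linked_glue.
have lm u v' : linked M2 (inl u) (inl v').
  apply: (linked_map (m := M2) (f := inl)) (cn u v') => z; last first.
    by have := ln (inl z); rewrite next_sum.
  have [->|ze] := eqVneq z e; first exact: linked_trans lyx (linked_sym gK2 lgyx).
  have [->|zg] := eqVneq z (glue m e).
    by rewrite gKm; apply: linked_trans lgyx (linked_sym gK2 lyx).
  have -> : inl (glue m z) = glue M2 (inl z); last exact: linked_glue.
  rewrite glue_rewireD ?gx ?gy //; first by rewrite glue_sum.
exists (D + side6)%type, M2; split.
- by rewrite card_sum cD card_side6 mulnS addnC.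
- split=> //; first exact: rewire_fpf.
  have l0 z : linked M2 z x.
    by case: z => u; [apply: linked_trans (lm u e) lyx | apply: lr].
  by move=> u v'; apply: linked_trans (l0 u) (linked_sym gK2 (l0 v')).
- rewrite /vertices turn_rewire // gx gy; set s1 := (tperm x _ * _)%g.
  have cM : #|porbits (turn M)| = v.+2 + 1.
    by rewrite -/(vertices M) card_vertices_sum vm vertices_torus6.
  have := porbits_mul_tperm (turn M) x (inl (glue m e)).
  rewrite /= -/s1 cM.
  have -> : x \notin porbit (turn M) (inl (glue m e)).
    apply/negP => h; suff : if x is inr _ then false else true by [].
    apply: (porbit_closed (P := fun z => if z is inr _ then false else true)) h => //.
    by move=> [u|u]; rewrite // turn_sum.
  have := porbits_mul_tperm s1 (inr (true, None)) y; rewrite /=.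
  (* The first merge involves the other endpoint of [e] and leaves the vertex at [y] intact. *)
  have -> : inr (true, None) \notin porbit s1 y.
    apply/negP => h; pose P (z : D + side6) := if z is inl u then start m u == start m e else false.
    suff : P (inr (true, None)) by [].
    apply: (porbit_closed (P := P)) h; last exact: eqxx.
    move=> [u|//] /= /eqP ue; rewrite permM tpermD //; last first.
      by apply/eqP => -[gu]; rewrite -ue -gu eqxx in nl.
    by rewrite turn_sum /= start_turn ue.
  rewrite !(addn1, doubleS, double0) /= => e1 e2.
  move/eqP: e2; rewrite addn2 !eqSS => /eqP e2.
  by move/eqP: e1; rewrite addn2 e2 !eqSS => /eqP.
Qed.

Lemma trimap_exists_genus n g : 2 * g < n ->
  exists2 v, trimap_exists n v & v + 2 * g = n + 2.
Proof.
have sph k : trimap_exists k.+1 k.+3.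
  by elim: k => [|k IH]; [exact: trimap_sphere | exact: trimap_add_vertex].
elim: g n => [|g IH] n.
  by case: n => // k _; exists k.+3; rewrite ?addn0 ?addn2.
case: n => // n gn; have [|v tv vE] := IH n; first by lia.
have [w vw] : exists w, v = w.+2 by exists v.-2; lia.
rewrite vw in tv vE; exists w.+1; first exact: trimap_add_handle.
lia.
Qed.

Lemma card_porbit2 (D : finType) (s : {perm D}) x :
  involutive s -> s x != x -> #|porbit s x| = 2.
Proof.
move=> sK sx; suff -> : porbit s x = [set x; s x] by rewrite cards2 eq_sym sx.
apply/setP => y; rewrite !inE; apply/idP/orP => [h|[]/eqP->].
- apply/orP; apply: (porbit_closed (P := fun z => (z == x) || (z == s x))) h;
    last by rewrite eqxx.
  by move=> z /orP[]/eqP->; rewrite ?sK eqxx ?orbT.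
- exact: porbit_id.
- by rewrite -eq_porbit_mem porbit_step.
Qed.

Lemma card_porbit3 (D : finType) (s : {perm D}) x :
  (forall z, s (s (s z)) = z) -> (forall z, s z != z) -> #|porbit s x| = 3.
Proof.
move=> s3 sN; have ux : uniq [:: x; s x; s (s x)].
  have s2 : s (s x) != x by apply/eqP => e; have := sN x; rewrite -{1}e s3 eqxx.
  by rewrite /= !inE !andbT negb_or (eq_sym x (s x)) sN (eq_sym x) s2 (eq_sym (s x)) sN.
rewrite -[3]/(size [:: x; s x; s (s x)]) -(card_uniqP ux); apply: eq_card => y.
apply/idP/idP => [h|].
  apply: (porbit_closed (P := fun z => z \in [:: x; s x; s (s x)])) h;
    last by rewrite inE eqxx.
  by move=> z; rewrite !inE => /or3P[]/eqP->; rewrite ?s3 eqxx ?orbT.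
rewrite !inE => /or3P[]/eqP->; rewrite ?porbit_id //.
  by rewrite -eq_porbit_mem porbit_step.
by rewrite -eq_porbit_mem !porbit_step.
Qed.

Lemma card_porbits_regular (D : finType) (s : {perm D}) k :
  (forall x, #|porbit s x| = k) -> #|porbits s| * k = #|D|.
Proof.
move=> h; rewrite -(sum_card_porbits s) -sum_nat_const.
by apply: eq_bigr => _ /imsetP[x _ ->].
Qed.

Lemma has_genusE n g (m : labelled_map (sides n)) : is_trimap m ->
  #|faces m| = 2 * n /\ (has_genus g m = (#|vertices m| + 2 * g == n + 2)).
Proof.
move=> [gK gN n3 nN _].
have f3 : #|faces m| * 3 = 6 * n.
  by rewrite card_porbits_regular ?card_ord // => x; apply: card_porbit3.
have e2 : #|edges m| * 2 = 6 * n.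
  by rewrite card_porbits_regular ?card_ord // => x; apply: card_porbit2.
have f2 : #|faces m| = 2 * n by lia.
have e3 : #|edges m| = 3 * n by lia.
split=> //; rewrite /has_genus /euler_char f2 e3.
by apply/eqP/eqP; lia.
Qed.

Lemma trimapP n g (m : labelled_map (sides n)) :
  m \in labelled_triangulations n g <->
  is_trimap m /\ #|vertices m| + 2 * g = n + 2.
Proof.
split=> [mLT|[tm vm]].
  have tm : is_trimap m := labelled_triangulationP mLT; split=> //.
  have [_ gE] := has_genusE g tm.
  by move: mLT; rewrite inE gE => /and3P[_ _ /eqP].
have [f2 gE] := has_genusE g tm; rewrite inE f2 gE vm !eqxx !andbT.
have [gK gN n3 nN cn] := tm; apply/andP; split; first exact/is_mapP.
by apply/forall_inP => _ /imsetP[x _ ->]; rewrite card_porbit3.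
Qed.

(** * Renaming the sides of a map *)

Section Relabel.
Variables (D D' : finType) (h : D -> D') (h' : D' -> D).
Hypotheses (hK : cancel h h') (hK' : cancel h' h).

Let conj_inj (s : {perm D}) : injective (fun z => h (s (h' z))).
Proof. by move=> x y /(can_inj hK)/perm_inj/(can_inj hK'). Qed.

Definition relabel (m : labelled_map D) : labelled_map D' :=
  (perm (@conj_inj (glue m)), perm (@conj_inj (next m)), h (root m)).

Variable m : labelled_map D.

Lemma glue_relabel z : glue (relabel m) z = h (glue m (h' z)). Proof. exact: permE. Qed.
Lemma next_relabel z : next (relabel m) z = h (next m (h' z)). Proof. exact: permE. Qed.
Lemma turn_relabel z : turn (relabel m) z = h (turn m (h' z)).
Proof. by rewrite !turnE glue_relabel next_relabel hK. Qed.

Lemma reach_relabel k x y : reach m k x y -> reach (relabel m) k (h x) (h y).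
Proof.
move=> r; suff [] : xpredT y /\ reach (relabel m) k (h x) (h y) by [].
apply: reach_map r => // z _.
  by rewrite -[in RHS](start_turn _ (h z)) turn_relabel hK.
have -> : h (glue m z) = glue (relabel m) (h z) by rewrite glue_relabel hK.
exact/reach_glue/reach_refl.
Qed.

Lemma card_vertices_relabel : #|vertices (relabel m)| = #|vertices m|.
Proof.
apply: (card_porbits_conj (f := h)); first by exists h'.
by move=> x; rewrite turn_relabel hK.
Qed.

Lemma relabel_trimap : is_trimap m -> is_trimap (relabel m).
Proof.
move=> [gK gN n3 nN cn]; split.
- by move=> z; rewrite !glue_relabel hK gK hK'.
- by move=> z; rewrite glue_relabel -{2}(hK' z) (inj_eq (can_inj hK)).
- by move=> z; rewrite !next_relabel !hK n3 hK'.
- by move=> z; rewrite next_relabel -{2}(hK' z) (inj_eq (can_inj hK)).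
- move=> x y; have [k r] := cn (h' x) (h' y); exists k.
  by rewrite -(hK' x) -(hK' y); apply: reach_relabel.
Qed.

End Relabel.

Lemma labelled_triangulations_neq0 n g : 2 * g < n ->
  labelled_triangulations n g != set0.
Proof.
move=> /trimap_exists_genus[v [D [m [cD tm vm]]] vE].
pose h (x : D) : sides n := cast_ord cD (enum_rank x).
pose h' (x : sides n) : D := enum_val (cast_ord (esym cD) x).
have hK : cancel h h' by move=> x; rewrite /h /h' cast_ordK enum_rankK.
have hK' : cancel h' h by move=> x; rewrite /h /h' enum_valK cast_ordKV.
apply/set0Pn; exists (relabel hK hK' m); apply/trimapP; split.
  exact: relabel_trimap.
by rewrite card_vertices_relabel vm.
Qed.

(** * Isomorphism classes *)

Definition prelabel (D : finType) (s : {perm D}) : labelled_map D -> labelled_map D :=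
  relabel (permK s) (permKV s).

Section Relabellings.
Variable D : finType.
Implicit Types (m : labelled_map D) (s : {perm D}).

Lemma isomorphicP m m' : reflect (exists s, m' = prelabel s m) (isomorphic m m').
Proof.
apply: (iffP existsP) => [[s /and3P[/forallP gs /forallP ns /eqP rs]]|[s ->]].
  exists s; apply: labelled_map_eq; last by rewrite -rs.
    by apply/permP => z; rewrite glue_relabel (eqP (gs _)) permKV.
  by apply/permP => z; rewrite next_relabel (eqP (ns _)) permKV.
exists s; apply/and3P; split=> //; apply/forallP => z.
  by rewrite glue_relabel permK.
by rewrite next_relabel permK.
Qed.

(** Two relabellings with the same result agree at the root, and agreement spreads along [glue] and
    [next]: rooted maps have no nontrivial automorphisms. Hence all classes have the same size. *)
Lemma prelabel_inj m : connected m -> injective (fun s => prelabel s m).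
Proof.
move=> cn s s' e; apply/permP => z.
have er : s (root m) = s' (root m) := congr1 (fun m => root m) e.
have eg x : s x = s' x -> s (glue m x) = s' (glue m x).
  move=> sx; have := congr1 (fun m => glue m (s x)) e.
  by rewrite !glue_relabel sx permK -sx permK.
have en x : s x = s' x -> s (next m x) = s' (next m x).
  move=> sx; have := congr1 (fun m => next m (s x)) e.
  by rewrite !next_relabel sx permK -sx permK.
have [k r] := cn (root m) z; apply/eqP; move/eqP in er.
apply: (proj1 (reach_map (m' := m) (P := fun z => s z == s' z) (f := fun=> z) _ _ _ _ er r)).
- by move=> x /eqP/eg->.
- by move=> x /eqP/eg/en; rewrite -turnE => ->.
- by [].
- by move=> x _; apply: reach_refl.
Qed.

Lemma vdist_relabel s m x y : connected m -> vdist (prelabel s m) (s x) (s y) = vdist m x y.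
Proof.
move=> cn; have [k r] := cn x y; apply/eqP; rewrite eqn_leq; apply/andP; split.
  exact/vdist_le/reach_relabel/(vdist_reach r).
have /vdist_reach r' := reach_relabel (permK s) (permKV s) r.
apply: vdist_le; have := reach_relabel (permKV s) (permK s) r'.
rewrite !permK; congr (reach _ _ _ _).
apply: labelled_map_eq; last by rewrite /Defs.root /= permK.
  by apply/permP => z; rewrite !glue_relabel !permK.
by apply/permP => z; rewrite !next_relabel !permK.
Qed.

Lemma diam_relabel s m : connected m -> diam (prelabel s m) = diam m.
Proof.
move=> cn; apply/eqP; rewrite eqn_leq; apply/andP; split; apply: diam_le => x y.
  by rewrite -(permKV s x) -(permKV s y) vdist_relabel // vdist_diam.
by rewrite -(vdist_relabel s) // vdist_diam.
Qed.

End Relabellings.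

Section Classes.
Variables n g : nat.
Notation D := (sides n).
Notation LT := (labelled_triangulations n g).
Implicit Type m : labelled_map D.

Lemma labelled_triangulation_relabel s m : m \in LT -> prelabel s m \in LT.
Proof.
move=> /trimapP[tm vm]; apply/trimapP; split; first exact: relabel_trimap.
by rewrite card_vertices_relabel.
Qed.

Lemma card_class C : C \in triangulations n g -> #|C| = #|{perm D}|.
Proof.
move=> /imsetP[m mLT ->]; have [_ _ _ _ cn] := labelled_triangulationP mLT.
rewrite -(card_imset _ (prelabel_inj cn)); apply: eq_card => m'; rewrite !in_set.
apply/andP/imsetP => [[_ /isomorphicP[s ->]]|[s _ ->]]; first by exists s.
split; last by apply/isomorphicP; exists s.
by have := labelled_triangulation_relabel s mLT; rewrite inE.
Qed.

Lemma triangulations_partition : partition (triangulations n g) LT.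
Proof.
by apply: equivalence_partitionP => x y z _ _ _; apply: isomorphic_equiv.
Qed.

Lemma card_triangulations : #|triangulations n g| * #|{perm D}| = #|LT|.
Proof.
by symmetry; apply: (card_uniform_partition card_class triangulations_partition).
Qed.

(** As all classes have [#|{perm D}|] elements, a uniform class amounts to a uniform labelled
    triangulation for any invariant quantity. *)
Lemma sum_classes (f : labelled_map D -> nat) :
  (forall m s, m \in LT -> f (prelabel s m) = f m) ->
  (\sum_(C in triangulations n g) (if [pick t in C] is Some t then f t else 0))
    * #|{perm D}| = \sum_(m in LT) f m.
Proof.
move=> fs; rewrite (set_partition_big _ triangulations_partition) /= big_distrl /=.
apply: eq_bigr => C CT; rewrite -(card_class CT).
move: CT => /imsetP[m0 mLT ->]; set C' := [set _ in _ | _].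
have fC m : m \in C' -> f m = f m0.
  by rewrite inE => /andP[_ /isomorphicP[s ->]]; apply: fs.
case: pickP => [t tC|C0].
  rewrite mulnC -sum_nat_const; apply: eq_bigr => m mC.
  by rewrite (fC t tC) (fC m mC).
by rewrite mul0n big_pred0.
Qed.

End Classes.

(** * Counting nearly diametral pairs *)

Definition near_diametral (n g h : nat) :=
  [set s : labelled_map (sides n) * sides n * sides n |
    (s.1.1 \in labelled_triangulations n g) &&
    (diam s.1.1 < vdist s.1.1 s.1.2 s.2 + h)].

Section Count.
Variables n g K h i : nat.
Notation D := (sides n).
Notation LT := (labelled_triangulations n g).
Hypotheses (n_gt1 : 1 < n) (nK : n <= K * (n + 2 - 2 * g)) (nK2 : K < n).
Let N := 48 * K ^ 2.
Hypotheses (iN : N * (8 * i) <= n) (ih : 8 * h + 11 <= 2 * i).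
Hypothesis ni : n <= 16 * N * i.

(* 48 N bounds the ratio 6n / 2i of the numbers of places where a bud can be put
   back to the number of available buds. *)
Lemma card_near_diametral :
  2 ^ i * #|near_diametral n g h| <=
    #|LT| * (6 * n) ^ 2 + 2 ^ i * (#|LT| * (2 * (6 * n)) * (48 * N) ^ h).
Proof.
pose few := [set s : labelled_map D * D * D | s.1.1 \in few_buds n g (4 * i)].
pose many := [set s in near_diametral n g h | 4 * i < #|buds s.1.1|].
have sub : near_diametral n g h \subset few :|: many.
  apply/subsetP => s sS; apply/setUP; case: (leqP #|buds s.1.1| (4 * i)) => b.
    by left; move: sS; rewrite !inE b => /andP[->].
  by right; rewrite in_set sS b.
have cfew : #|few| = #|few_buds n g (4 * i)| * (6 * n) ^ 2.
  have -> : few = setX (setX (few_buds n g (4 * i)) setT) setT.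
    by apply/setP => s; rewrite !inE !andbT.
  by rewrite !cardsX !cardsT card_ord -mulnn [RHS]mulnA.
have cmany : #|many| * (2 * i) ^ h <= #|LT| * (2 * (6 * n)) * (6 * n) ^ h.
  (* More than 4i buds leave 2i available at every step, the rest covering the reserve of 8h +
     12. *)
  have manyP m x y : (m, x, y) \in many ->
      [/\ m \in LT, 2 * i + 8 * h + 12 <= #|buds m| & diam m < vdist m x y + h].
    rewrite in_set => /andP[]; rewrite in_set /= => /andP[mt md] mb; split=> //.
    by apply: leq_trans mb; lia.
  by have := bad_tentacles n_gt1 manyP; rewrite card_ord.
have n0 : 0 < n by apply: ltnW.
have i0 : 0 < 2 * i by lia.
have cmany' : #|many| <= #|LT| * (2 * (6 * n)) * (48 * N) ^ h.
  rewrite -(@leq_pmul2r ((2 * i) ^ h)) ?expn_gt0 ?i0 //.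
  apply: leq_trans cmany _; rewrite -[leqRHS]mulnA leq_mul2l; apply/orP; right.
  rewrite -expnMn; case: (h) => // k; rewrite leq_exp2r //.
  by apply: leq_trans (leq_mul (leqnn 6) ni) _; lia.
have vert m : m \in LT -> n <= K * #|vertices m| /\ 1 < #|vertices m|.
  move=> /trimapP[_ vm]; have vE : #|vertices m| = n + 2 - 2 * g by rewrite -vm addnK.
  rewrite vE; split=> //; rewrite ltnNge; apply/negP => v1.
  have : n <= K * 1 by apply: leq_trans nK _; rewrite leq_mul2l v1 orbT.
  by rewrite muln1 leqNgt nK2.
have rare := few_buds_rare n0 vert iN.
apply: leq_trans (leq_mul (leqnn _) (leq_trans (subset_leq_card sub) (leq_card_setU _ _))) _.
rewrite mulnDr; apply: leq_add; last by rewrite leq_mul2l cmany' orbT.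
by rewrite cfew mulnA leq_mul2r rare orbT.
Qed.

End Count.

Lemma sqr_le_exp4 h : h.+1 ^ 2 <= 4 ^ h.
Proof. elim: h => // h IH; rewrite [4 ^ _]expnS; nia. Qed.

(** With [Q] equal to [48 * N], logarithms to base Q^2 keep Q^h below the square root of n, while
    [i] is linear in n. Both terms of [card_near_diametral] are then negligible. *)
Lemma near_diametral_rare K M : 0 < K -> exists n0, forall n g, n0 <= n ->
  n <= K * (n + 2 - 2 * g) ->
  M * #|near_diametral n g (trunc_log ((2304 * K ^ 2) ^ 2) n).+1|
    <= 2 * (#|labelled_triangulations n g| * (6 * n) ^ 2).
Proof.
move=> K0; have [N NE] : exists N, N = 48 * K ^ 2 by exists (48 * K ^ 2).
have [Q QN] : exists Q, Q = 48 * N by exists (48 * N).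
have -> : 2304 * K ^ 2 = Q by rewrite QN NE mulnA.
have N0 : 0 < N by rewrite NE muln_gt0 expn_gt0 K0.
have Q1 : 1 < Q by rewrite QN; lia.
(* [a] makes [i] at least 1444 N + M, and [c] makes M Q^(h+1) at most n. *)
have [a aE] : exists a, a = 8 * N * (1444 * N + M) by exists (8 * N * (1444 * N + M)).
have [c cE] : exists c, c = M ^ 2 * Q ^ 2 by exists (M ^ 2 * Q ^ 2).
exists (a + c + K + 2) => n g nn0 nK.
have [h hE] : exists h, h = (trunc_log (Q ^ 2) n) by exists (trunc_log (Q ^ 2) n).
rewrite -hE; have [i iE] : exists i, i = n %/ (8 * N) by exists (n %/ (8 * N)).
have n1 : 1 < n by lia.
have nK2 : K < n by lia.
have na : a <= n by lia.
have nc : c <= n by lia.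
clear nn0.
have Qh : (Q ^ h) ^ 2 <= n.
  have -> : (Q ^ h) ^ 2 = (Q ^ 2) ^ h by rewrite -!expnM mulnC.
  by rewrite hE; apply: trunc_logP; [rewrite (ltn_exp2l 0) | apply: ltnW].
have iM : 1444 * N + M <= i.
  by rewrite iE leq_divRL ?muln_gt0 // mulnC -aE.
have iN : N * (8 * i) <= n.
  by rewrite mulnCA mulnA mulnC iE leq_divM.
have i0 : 0 < i by lia.
have ni : n <= 16 * N * i.
  have := ltn_ceil n (_ : 0 < 8 * N); rewrite -iE muln_gt0 N0 => /(_ isT) lt.
  apply: leq_trans (ltnW lt) _.
  have -> : 16 * N * i = (2 * i) * (8 * N) by rewrite [RHS]mulnACA -mulnA (mulnC N).
  by rewrite leq_mul2r; apply/orP; right; lia.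
have hn : h.+1 ^ 2 <= n.
  apply: leq_trans Qh; apply: leq_trans (sqr_le_exp4 h) _.
  rewrite -[4]/(2 ^ 2) -expnM mulnC expnM leq_exp2r //.
  by case: (h) => // k; rewrite leq_exp2r.
have ih : 8 * h.+1 + 11 <= 2 * i.
  (* Here 8(h + 1) + 11 is at most 19(h + 1), and 1444 is 4 times the square of 19. *)
  have h19 : 19 * h.+1 <= 2 * i.
    rewrite -leq_sqr !expnMn; apply: leq_trans (leq_mul (leqnn _) (leq_trans hn ni)) _.
    have -> : 19 ^ 2 * (16 * N * i) = 4 * ((1444 * N) * i) by rewrite !mulnA.
    by rewrite leq_mul2l -mulnn leq_mul2r (leq_trans _ iM) ?leq_addr ?orbT.
  by apply: leq_trans h19; lia.
have main : 2 ^ i * #|near_diametral n g h.+1| <=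
    #|labelled_triangulations n g| * (6 * n) ^ 2 +
    2 ^ i * (#|labelled_triangulations n g| * (2 * (6 * n)) * Q ^ h.+1).
  by rewrite QN NE; apply: card_near_diametral nK nK2 _ ih _; rewrite -?NE.
have M2 : M <= 2 ^ i.
  by apply: leq_trans (ltnW (ltn_expl i (ltnSn 1))); apply: leq_trans iM; apply: leq_addl.
have MQ : M * Q ^ h.+1 <= n.
  rewrite -leq_sqr (expnS Q h) mulnA expnMn; apply: leq_trans (leq_mul (leqnn _) Qh) _.
  by rewrite expnMn -cE -[leqRHS]mulnn leq_mul2r nc orbT.
rewrite -(@leq_pmul2l (2 ^ i)) ?expn_gt0 // mulnCA.
apply: leq_trans (leq_mul (leqnn M) main) _.
move: M2 MQ; move: #|_| (2 ^ i) (Q ^ h.+1) => L P q M2 MQ.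
rewrite mulnDr [2 * (L * _)]mul2n -addnn mulnDr; apply: leq_add.
  by rewrite leq_mul2r M2 orbT.
rewrite mulnCA leq_mul2l; apply/orP; right.
have -> : M * (L * (2 * (6 * n)) * q) = L * (12 * n * (M * q)) by nia.
rewrite leq_mul2l; apply/orP; right.
apply: leq_trans (leq_mul (leqnn _) MQ) _.
by rewrite expnMn -[n ^ 2]mulnn -mulnA leq_mul2r orbT.
Qed.

(** * From counting labelled triangulations to probabilities *)

Section ProbLabelled.
Import GRing.Theory Num.Theory.
Local Open Scope ring_scope.

(** The event depends on the diameter and a distance only, so it is invariant under relabelling, and
    its probability is a proportion among labelled triples. *)
Lemma prob_labelled (R : realType) (n g : nat) (E : nat -> nat -> bool) :
  labelled_triangulations n g != set0 -> (0 < n)%N ->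
  prob_triangulation_edges R g (fun (m : labelled_map (sides n)) x y =>
    E (diam m) (dist m (start m x) (start m y))) =
  1 - #|[set s : labelled_map (sides n) * sides n * sides n |
        (s.1.1 \in labelled_triangulations n g)
        && ~~ E (diam s.1.1) (vdist s.1.1 s.1.2 s.2)]|%:R
      / (#|labelled_triangulations n g| * (6 * n) ^ 2)%N%:R.
Proof.
move=> LT0 n0.
pose T := labelled_map (sides n); pose LT := labelled_triangulations n g.
pose f (m : T) := #|[set e : sides n * sides n | E (diam m) (vdist m e.1 e.2)]|.
have fs (m : T) s : m \in LT -> f (prelabel s m) = f m.
  move=> mLT; have [_ _ _ _ cn] := labelled_triangulationP mLT.
  pose s2 (e : sides n * sides n) := (s e.1, s e.2).
  have s2I : injective s2 by move=> [x y] [x' y'] [/perm_inj-> /perm_inj->].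
  rewrite /f -[RHS](card_imset _ s2I); apply: eq_card => -[x y].
  apply/idP/imsetP; rewrite in_set /= diam_relabel //.
    move=> h; exists (s^-1%g x, s^-1%g y); last by rewrite /s2 /= !permKV.
    by rewrite in_set /= -(vdist_relabel s) // !permKV.
  by move=> [[x' y']]; rewrite in_set /= => h [-> ->]; rewrite vdist_relabel.
have cDD : #|{: sides n * sides n}| = ((6 * n) ^ 2)%N by rewrite card_prod card_ord mulnn.
have sC := sum_classes fs; have cT := card_triangulations n g.
have F0 : (0 < #|{perm (sides n)}|)%N by apply/card_gt0P; exists 1%g.
have L0 : (0 < #|LT|)%N by rewrite card_gt0.
have C0 : (0 < #|triangulations n g|)%N by move: L0; rewrite /LT -cT muln_gt0 => /andP[].
have bad : (\sum_(m in LT) f m + #|[set s : T * sides n * sides n |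
        (s.1.1 \in LT) && ~~ E (diam s.1.1) (vdist s.1.1 s.1.2 s.2)]|
    = #|LT| * (6 * n) ^ 2)%N.
  pose assoc (p : T * (sides n * sides n)) := (p.1, p.2.1, p.2.2).
  have assocI : injective assoc by move=> [? [? ?]] [? [? ?]] [-> -> ->].
  have -> : [set s : T * sides n * sides n |
        (s.1.1 \in LT) && ~~ E (diam s.1.1) (vdist s.1.1 s.1.2 s.2)] =
      assoc @: [set p : T * (sides n * sides n) |
        (p.1 \in LT) && ~~ E (diam p.1) (vdist p.1 p.2.1 p.2.2)].
    apply/setP => -[[m x] y]; apply/idP/imsetP => [h|[[m' [x' y']]]].
      by exists (m, (x, y)) => //; move: h; rewrite !in_set.
    by rewrite !in_set /= => h [-> -> ->].
  rewrite (card_imset _ assocI).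
  rewrite (card_pairs (fun m (e : sides n * sides n) =>
    (m \in LT) && ~~ E (diam m) (vdist m e.1 e.2))).
  rewrite -sum_nat_const [in LHS]big_mkcond [in RHS]big_mkcond -big_split /=.
  apply: eq_bigr => m _; case: ifP => mLT; last first.
    by rewrite (_ : [set _ | _] = set0) ?cards0 //; apply/setP => e; rewrite !in_set.
  rewrite -cDD -(cardsC [set e : sides n * sides n | E (diam m) (vdist m e.1 e.2)]).
  by congr (_ + _)%N; apply: eq_card => e; rewrite !in_set.
have -> : prob_triangulation_edges R g (fun (m : labelled_map (sides n)) x y =>
    E (diam m) (dist m (start m x) (start m y))) =
    (\sum_(m in LT) f m)%N%:R / (#|LT| * (6 * n) ^ 2)%N%:R.
  rewrite /prob_triangulation_edges /prob_edges -sC.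
  have -> : \sum_(C in triangulations n g)
      (if [pick t in C] is Some t then
       #|[set e : sides n * sides n | E (diam t) (dist t (start t e.1) (start t e.2))]|%:R / #|{: sides n * sides n}|%:R else 0)
     = (\sum_(C in triangulations n g) (if [pick t in C] is Some t then f t else 0))%N%:R / ((6 * n) ^ 2)%N%:R :> R.
    rewrite natr_sum mulr_suml; apply: eq_bigr => C _; rewrite cDD.
    by case: pickP => // _; rewrite mul0r.
  rewrite -cT.
  rewrite !natrM; field.
  by rewrite !pnatr_eq0 -?lt0n F0 C0 ?expn_gt0 ?muln_gt0 ?n0.
have N0 : (#|LT| * (6 * n) ^ 2)%N%:R != 0 :> R.
  by rewrite pnatr_eq0 -lt0n muln_gt0 L0 expn_gt0 muln_gt0 n0.
by apply/esym/eqP; rewrite subr_eq -mulrDl -natrD bad divff.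
Qed.

End ProbLabelled.

(* Choice of the constants and passage to the limit *)
From mathcomp Require Import all_classical all_reals all_analysis lra.
Import Order.TTheory GRing.Theory Num.Theory.
Import numFieldNormedType.Exports.
Local Open Scope classical_set_scope.
Local Open Scope ring_scope.

Theorem proposition17 (R : realType) (theta : R) :
  0 < theta -> theta < 1 / 2 ->
  exists2 t : R, 0 < t &
    forall g : nat -> nat,
      (fun n : nat => (g n)%:R / n%:R : R) @ \oo --> theta ->
      (fun n : nat =>
         prob_triangulation_edges R (g n)
           (fun (m : labelled_map (sides n)) (x y : sides n) =>
              t * ln n%:R
                <= (diam m)%:R - (dist m (start m x) (start m y))%:R))
        @ \oo --> (1 : R).
Proof.
move=> theta0 theta2; pose eta : R := (1 / 2 - theta) / 2.
have eta0 : 0 < eta by rewrite /eta; lra.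
(* For large n, g stays below (1/2 - eta) n, so the number of vertices is at least eta n and thus at
   least n / K. *)
have [K K0 Keta] : exists2 K, (0 < K)%N & 1 <= K%:R * eta.
  exists (Num.bound eta^-1).+1 => //.
  have := archi_boundP (ltW (_ : 0 < eta^-1)); rewrite invr_gt0 => /(_ eta0) h.
  by rewrite -ler_pdivrMr // mul1r ltW // (lt_le_trans h) // ler_nat.
have [Q QE] : exists Q, Q = (2304 * K ^ 2)%N by exists (2304 * K ^ 2)%N.
have Q1 : (1 < Q)%N by rewrite QE; nia.
have lnQ : 0 < ln Q%:R :> R by rewrite ln_gt0 // ltr1n.
(* This turns t log n into the logarithm of n to base Q^2, which is at most the [h] chosen below. *)
exists (2 * ln Q%:R)^-1; first by rewrite invr_gt0 mulr_gt0.
move=> g gtheta; apply/cvgrPdist_le => eps eps0.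
(* The proportion of bad triples will be at most 2 / M. *)
have [M M0 epsM] : exists2 M, 0 < M%:R :> R & 2 <= eps * M%:R.
  exists (Num.bound (2 / eps)).+1; first by rewrite ltr0n.
  have := archi_boundP (ltW (_ : 0 < 2 / eps)); rewrite divr_gt0 // => /(_ isT) h.
  by rewrite mulrC -ler_pdivrMr // ltW // (lt_le_trans h) // ler_nat.
have [n0 n0P] := near_diametral_rare M K0; rewrite -QE in n0P.
have near_theta : \forall n \near \oo, `|theta - (g n)%:R / n%:R| < eta.
  by move/cvgrPdist_lt : gtheta; apply.
near=> n.
have nn0 : (n0 <= n)%N by near: n; exact: nbhs_infty_ge.
have n1 : (1 < n)%N by near: n; exact: nbhs_infty_ge.
have nR0 : 0 < n%:R :> R by rewrite ltr0n ltnW.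
have gn : (g n)%:R + eta * n%:R < n%:R / 2 :> R.
  have : `|theta - (g n)%:R / n%:R| < eta by near: n.
  rewrite ltr_norml => /andP[h _].
  have : (g n)%:R / n%:R < 1 / 2 - eta :> R by rewrite /eta in h *; lra.
  by rewrite ltr_pdivrMr //; lra.
have g2 : (2 * g n < n)%N.
  rewrite -(ltr_nat R) natrM; have : 0 < eta * n%:R by rewrite mulr_gt0.
  lra.
have nK : (n <= K * (n + 2 - 2 * g n))%N.
  rewrite -(ler_nat R) natrM natrB ?natrD ?natrM; last by lia.
  have h1 : eta * n%:R <= n%:R + 2 - 2 * (g n)%:R :> R.
    have : 0 < eta * n%:R by rewrite mulr_gt0.
    lra.
  apply: (@le_trans _ _ (K%:R * (eta * n%:R))).
    by rewrite mulrA ler_peMl // ltW.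
  rewrite ler_pM2l; last by rewrite ltr0n.
  lra.
set E := fun a b : nat => (2 * ln Q%:R)^-1 * ln n%:R <= a%:R - b%:R :> R.
rewrite -[prob_triangulation_edges _ _ _]/(prob_triangulation_edges R (g n)
  (fun (m : labelled_map (sides n)) x y => E (diam m) (dist m (start m x) (start m y)))).
rewrite prob_labelled ?labelled_triangulations_neq0 //; last exact: ltnW.
rewrite opprB addrC subrK.
set h := (trunc_log (Q ^ 2) n).+1.
have lnh : (2 * ln Q%:R)^-1 * ln n%:R <= h%:R :> R.
  rewrite ler_pdivrMl ?mulr_gt0 //.
  have nQ : n%:R <= ((Q ^ 2) ^ h)%N%:R :> R.
    by rewrite ler_nat ltnW // trunc_log_ltn // (ltn_exp2l 0).
  have : ln n%:R <= ln ((Q ^ 2) ^ h)%N%:R :> R.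
    by rewrite ler_ln ?posrE // ltr0n !expn_gt0 (ltnW Q1).
  rewrite !natrX !lnXn ?exprn_gt0 ?ltr0n ?(ltnW Q1) //.
  move=> ln_le; apply: le_trans ln_le _.
  by rewrite -mulrnA -[X in X <= _]mulr_natr natrM mulrA (mulrC (ln Q%:R)).
set Y := #|_|; set tot := (#|_| * _)%N.
have tot0 : 0 < tot%:R :> R.
  rewrite ltr0n muln_gt0 card_gt0 labelled_triangulations_neq0 //.
  by rewrite expn_gt0 muln_gt0 (ltnW n1).
(* If the event fails, the defect is below t log n, hence below [h], and the triple is nearly
   diametral. *)
have YM : (M * Y <= 2 * tot)%N.
  apply: leq_trans (n0P n (g n) nn0 nK); rewrite leq_mul2l; apply/orP; right.
  apply: subset_leq_card; apply/fintype.subsetP => s; rewrite !finset.in_set.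
  move=> /andP[-> nE] /=; move: nE; rewrite /E -ltNge => lt.
  rewrite -(ltr_nat R) natrD -ltrBlDl; exact: lt_le_trans lt lnh.
clearbody tot Y.
rewrite ger0_norm ?divr_ge0 ?ler0n // ler_pdivrMr // -(ler_pM2l M0).
move: YM; rewrite -(ler_nat R) !natrM => YM; apply: le_trans YM _.
by rewrite mulrA (mulrC M%:R) ler_pM2r //.
Unshelve. all: by end_near.
Qed.
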